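(* There is no $c$-Wieferich prime of degree $d$ in $\mathbf{F}_p[T]$ (that is, with $q=p$) for each of the following pairs $(d,p)$ (all of which satisfy $p\nmid d$): - $d=5$ and $p\in\{3,7,11,13,17,19,23,29,31,37\}$; - $d=6$ and $p\in\{5,7,11,13,17,19,23\}$; - $d=7$ and $p\in\{3,5,11,13\}$; - $d=8$ and $p\in\{3,5,7\}$; - $d=9$ and $p=5$; - $d=10$ and $p=3$; - $d=11$ and $p\in\{3,5\}$; - $d=13$ and $p=3$; - $d=14$ and $p=3$.
   Context: Let $q$ be a power of an odd prime $p$ (here $q=p$) and $A=\mathbf{F}_q[T]$. The Carlitz module is the $\mathbf{F}_q$-algebra homomorphism $\rho\colon A\to A\{\tau\}$ into the twisted polynomial ring (with $\tau x=x^q\tau$ for $x\in A$) determined by $\rho_T=T+\tau$. For $a\in A$, $\rho_a(x)$ denotes the associated $\mathbf{F}_q$-linear polynomial: if $\rho_a=\sum_i a_i\tau^i$ then $\rho_a(x)=\sum_i a_i x^{q^i}$; so $\rho_a(1)=\sum_i a_i$. A ''prime'' of $A$ is an irreducible polynomial. A monic prime $P\in A$ is called a $c$-Wieferich prime (to base $1$) if $\rho_P(1)\equiv 1\pmod{P^2}$ (the letter $c$ is part of the name). *)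

(* Defs.v *)
From HB Require Import structures.
From mathcomp Require Import all_boot all_order all_fingroup all_algebra.
From mathcomp Require Import all_solvable all_field.

Set Implicit Arguments.
Unset Strict Implicit.
Unset Printing Implicit Defensive.

Import GRing.Theory.
Local Open Scope ring_scope.

(* The ring A{tau} of twisted polynomials over A = F[T], where T is 'X,
   q = #|F| and tau x = x^q tau for x in A. The element \sum_i a_i tau^i is
   represented by the sequence of its left coefficients a_i, stored as a
   polynomial over A. The alias carries the twisted product, not the one of
   {poly {poly F}}. *)
Definition twpoly (F : finFieldType) := {poly {poly F}}.

HB.instance Definition _ (F : finFieldType) := GRing.Zmodule.on (twpoly F).

Section TwistedPolynomials.

Variable F : finFieldType.
Local Notation q := #|F|.
Implicit Types (x y : {poly F}) (f g h : twpoly F).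

Definition twcoef f i : {poly F} := (f : {poly {poly F}})`_i.
Definition twsize f : nat := size (f : {poly {poly F}}).

Lemma twpolyP f g : (forall i, twcoef f i = twcoef g i) <-> f = g.
Proof. by split=> [/polyP|->]. Qed.

Lemma twcoefD f g i : twcoef (f + g) i = twcoef f i + twcoef g i.
Proof. exact: coefD. Qed.

Lemma pchar_nat_card : [pchar {poly F}].-nat q.
Proof.
have [p p_pr chFp] := finPcharP F.
have : pgroup p [set: F] by apply: abelem_pgroup (fin_ring_pchar_abelem chFp).
rewrite /pgroup cardsT; apply: sub_in_pnat => r _ /eqP->.
by rewrite pchar_poly.
Qed.

Lemma frobD i x y : (x + y) ^+ (q ^ i) = x ^+ (q ^ i) + y ^+ (q ^ i).
Proof. by apply: exprDn_pchar; rewrite pnatX pchar_nat_card. Qed.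

Lemma card_exp_gt0 i : (0 < q ^ i)%N.
Proof. by rewrite expn_gt0 (ltnW (finNzRing_gt1 F)). Qed.

Lemma frob0 i : (0 : {poly F}) ^+ (q ^ i) = 0.
Proof. by rewrite expr0n eqn0Ngt card_exp_gt0. Qed.

Lemma frob_sum i I r (P : pred I) (E : I -> {poly F}) :
  (\sum_(j <- r | P j) E j) ^+ (q ^ i) = \sum_(j <- r | P j) E j ^+ (q ^ i).
Proof.
by apply: (big_morph (fun x => x ^+ (q ^ i))); [apply: frobD | apply: frob0].
Qed.

Lemma frobC i (c : F) : (c%:P : {poly F}) ^+ (q ^ i) = c%:P.
Proof.
elim: i => [|i IHi]; first by rewrite expr1.
by rewrite expnS exprM -polyC_exp expf_card.
Qed.

(* (a tau^j) (b tau^k) = a b^(q^j) tau^(j+k) *)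
Definition twmul f g : twpoly F :=
  \poly_(i < (twsize f + twsize g).-1)
    \sum_(j < i.+1) twcoef f j * twcoef g (i - j) ^+ (q ^ j).

Lemma twcoef_mul f g i :
  twcoef (twmul f g) i =
    \sum_(j < i.+1) twcoef f j * twcoef g (i - j) ^+ (q ^ j).
Proof.
rewrite /twmul /twcoef coef_poly ltn_predRL; case: leqP => // le_pq_i1.
rewrite big1 // => j _; have [lq_p_j|lt_j_p] := leqP (twsize f) j.
  by rewrite nth_default ?mul0r.
rewrite [X in X ^+ _]nth_default ?frob0 ?mulr0 // leq_subRL -ltnS //.
by rewrite (leq_trans _ le_pq_i1) // ltn_add2r.
Qed.

Lemma twcoef_mul_rev f g i :
  twcoef (twmul f g) i =
    \sum_(j < i.+1) twcoef f (i - j) * twcoef g j ^+ (q ^ (i - j)).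
Proof.
rewrite twcoef_mul (reindex_inj rev_ord_inj) /=.
by apply: eq_bigr => j _; rewrite (sub_ordK j).
Qed.

Lemma twmulA : associative twmul.
Proof.
move=> f g h; apply/twpolyP=> i; rewrite twcoef_mul twcoef_mul_rev.
pose coef3 j k := twcoef f j *
  (twcoef g (i - j - k) ^+ (q ^ j) * twcoef h k ^+ (q ^ (i - k))).
transitivity (\sum_(j < i.+1) \sum_(k < i.+1 | (k <= i - j)%N) coef3 j k).
  apply: eq_bigr => /= j _.
  rewrite twcoef_mul_rev frob_sum big_distrr /=.
  rewrite (big_ord_narrow_leq (leq_subr _ _)); apply: eq_bigr => k _ /=.
  rewrite exprMn -exprM -expnD; congr (_ * (_ * _ ^+ (q ^ _))).
  rewrite subnAC subnK // leq_subRL ?(leq_trans (leq_ord k) (leq_subr _ _)) //.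
  by rewrite addnC -leq_subRL ?leq_ord.
rewrite (exchange_big_dep predT) //=; apply: eq_bigr => k _.
transitivity (\sum_(j < i.+1 | (j <= i - k)%N) coef3 j k).
  apply: eq_bigl => j; rewrite -ltnS -(ltnS j) -!subSn ?leq_ord //.
  by rewrite -subn_gt0 -(subn_gt0 j) -!subnDA addnC.
rewrite (big_ord_narrow_leq (leq_subr _ _)) twcoef_mul big_distrl /=.
by apply: eq_bigr => j _; rewrite /coef3 -!subnDA addnC mulrA.
Qed.

Definition twone : twpoly F := (1%:P : {poly {poly F}}).

Lemma twmul1f : left_id twone twmul.
Proof.
move=> f; apply/twpolyP => i; rewrite twcoef_mul big_ord_recl subn0.
rewrite big1 => [|j _]; rewrite /twcoef coefC /= ?mul0r //.
by rewrite expr1 mul1r addr0.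
Qed.

Lemma twmulf1 : right_id twone twmul.
Proof.
move=> f; apply/twpolyP => i; rewrite twcoef_mul_rev big_ord_recl subn0.
rewrite big1 => [|j _]; rewrite /twcoef coefC /= ?frob0 ?mulr0 //.
by rewrite expr1n mulr1 addr0.
Qed.

Lemma twmulDl : left_distributive twmul +%R.
Proof.
move=> f g h; apply/twpolyP=> i; rewrite twcoefD !twcoef_mul -big_split.
by apply: eq_bigr => j _; rewrite twcoefD mulrDl.
Qed.

Lemma twmulDr : right_distributive twmul +%R.
Proof.
move=> f g h; apply/twpolyP=> i; rewrite twcoefD !twcoef_mul -big_split.
by apply: eq_bigr => j _; rewrite twcoefD frobD mulrDr.
Qed.

Lemma twone_neq0 : twone != 0.
Proof. by rewrite polyC_eq0 oner_neq0. Qed.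

HB.instance Definition _ := GRing.Zmodule_isNzRing.Build (twpoly F)
  twmulA twmul1f twmulf1 twmulDl twmulDr twone_neq0.

Definition twscale (c : F) f : twpoly F :=
  (c%:P : {poly F}) *: (f : {poly {poly F}}).

Lemma twcoefZ c f i : twcoef (twscale c f) i = c%:P * twcoef f i.
Proof. exact: coefZ. Qed.

Lemma twscaleA a b f : twscale a (twscale b f) = twscale (a * b) f.
Proof. by rewrite /twscale scalerA polyCM. Qed.

Lemma twscale1 : left_id 1 twscale.
Proof. by move=> f; rewrite /twscale scale1r. Qed.

Lemma twscaleDr : right_distributive twscale +%R.
Proof. by move=> c f g; apply: scalerDr. Qed.

Lemma twscaleDl f : {morph twscale^~ f : a b / a + b}.
Proof. by move=> a b; rewrite /twscale polyCD; apply: scalerDl. Qed.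

HB.instance Definition _ := GRing.Zmodule_isLmodule.Build F (twpoly F)
  twscaleA twscale1 twscaleDr twscaleDl.

Lemma twscaleAl (c : F) f g : c *: (f * g) = (c *: f) * g.
Proof.
apply/twpolyP=> i; rewrite twcoefZ !twcoef_mul big_distrr /=.
by apply: eq_bigr => j _; rewrite twcoefZ mulrA.
Qed.

HB.instance Definition _ := GRing.Lmodule_isLalgebra.Build F (twpoly F)
  twscaleAl.

(* Constants of F are fixed by the q-power map, hence central in A{tau}. *)
Lemma twscaleAr (c : F) f g : c *: (f * g) = f * (c *: g).
Proof.
apply/twpolyP=> i; rewrite twcoefZ !twcoef_mul big_distrr /=.
by apply: eq_bigr => j _; rewrite twcoefZ exprMn frobC mulrCA.
Qed.

HB.instance Definition _ := GRing.Lalgebra_isAlgebra.Build F (twpoly F)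
  twscaleAr.

Definition twC x : twpoly F := (x%:P : {poly {poly F}}).
Definition tau : twpoly F := ('X : {poly {poly F}}).

Lemma twcoefC x i : twcoef (twC x) i = if i == 0%N then x else 0.
Proof. exact: coefC. Qed.

Lemma twcoef_tau i : twcoef tau i = (i == 1%N)%:R.
Proof. exact: coefX. Qed.

Lemma twC_mul x y : twC (x * y) = twC x * twC y.
Proof.
apply/twpolyP=> i; rewrite twcoef_mul big_ord_recl big1 => [|j _].
  rewrite subn0 expr1 addr0 !twcoefC /=.
  by case: ifP => _ //; rewrite mulr0.
by rewrite twcoefC /= mul0r.
Qed.

Lemma tau_twC x : tau * twC x = twC (x ^+ q) * tau.
Proof.
apply/twpolyP=> i; rewrite !twcoef_mul.
case: i => [|i].
  by rewrite !big_ord1 !twcoef_tau !twcoefC /= mul0r expr1 mulr0.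
rewrite [LHS]big_ord_recl [RHS]big_ord_recl /= twcoef_tau mul0r add0r.
rewrite [X in _ = _ + X]big1 => [|j _]; last by rewrite twcoefC /= mul0r.
rewrite big_ord_recl big1 => [|j _]; last by rewrite twcoef_tau /= mul0r.
rewrite !addr0 !twcoef_tau !twcoefC /= mul1r expn1 expr1.
rewrite subSS subn0; case: i => [|i] /=; first by rewrite mulr1.
by have := frob0 1; rewrite expn1 => ->; rewrite mulr0.
Qed.

Definition tweval f x : {poly F} :=
  \sum_(i < twsize f) twcoef f i * x ^+ (q ^ i).

Definition carlitz : {poly F} -> twpoly F := horner_alg (twC 'X + tau).

HB.instance Definition _ := GRing.LRMorphism.on carlitz.

Lemma carlitzX : carlitz 'X = twC 'X + tau.
Proof. exact: horner_algX. Qed.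

Lemma carlitz_unique (rho : {lrmorphism {poly F} -> twpoly F}) :
  rho 'X = twC 'X + tau -> rho =1 carlitz.
Proof. by move=> rhoX x; rewrite (poly_alg_initial rho) rhoX. Qed.

(* To base 1. *)
Definition c_wieferich (P : {poly F}) : Prop :=
  [/\ P \is monic, irreducible_poly P &
      P ^+ 2 %| tweval (carlitz P) 1 - 1].

End TwistedPolynomials.

(* Main.v *)
Require Import Defs.
From mathcomp Require Import all_boot all_order all_fingroup all_algebra.
From mathcomp Require Import all_solvable all_field qfpoly ring zify.

Set Implicit Arguments.
Unset Strict Implicit.
Unset Printing Implicit Defensive.

Import GRing.Theory.

(** Let P be a monic prime of degree d over F_p and theta a root of P in the
field L = F_p[X]/(P), which has p^d elements. Put C_n = rho_{T^n}(1), so that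
C_{n+1} = T C_n + C_n^p and, for derivatives, C'_{n+1} = C_n + T C'_n. If P^2
divides rho_P(1) - 1, then the derivative of rho_P(1) = sum_n P_n C_n vanishes
at theta. As P is the product of the X - theta^(p^i), i < d, this derivative can
be evaluated in closed form: its value at theta is G_{d-1}, where G_0 = 1 and
G_k = 1 + (theta - theta^(p^k)) G_{k-1} ([wieferich_carlitz_horner]).

With z = theta - theta^p the differences are partial traces, theta - theta^(p^j)
= S_j(z) = z + z^p + ... + z^(p^(j-1)), so G_{d-1} depends on z only, and z has
trace S_d(z) = 0. Hence a Wieferich prime of degree d gives an element z of
trace 0 in F_(p^d) with E(z) = 0, where E(z) = 1 + S_{d-1}(z) (1 + S_{d-2}(z)
(... (1 + S_1(z)))). For each of the pairs (d, p) an enumeration shows that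
there is none.

Two symmetries make the enumeration short. First, E(z^p) = E(z)^p. Second, for c
in F_p^* one has E(cz) = sum_i c^i m_i with m_i = S_{d-1}(z)...S_{d-i}(z), so
that all scalar multiples of z are treated with the same products. About p^(d-1)
/ (d (p-1)) elements z remain. They are enumerated through a normal basis gamma,
gamma^p, ... of trace 1: z becomes a word of d letters modulo p, Frobenius
becomes rotation, trace zero means that the letters sum to 0 modulo p, and every
orbit contains a word that is lexicographically minimal among the rotations of
its multiples ([exists_canonical]). A depth-first search extends prefixes one
letter at a time and abandons a prefix as soon as a multiple of one of its
factors is smaller than the beginning of the word ([step_sound],
[search_sound]).

The computations take place on words over a finite alphabet: the field is
presented as polynomials in x of degree less than d modulo x^d - nu(x), k
consecutive coefficients are coded by one symbol, and the operations on symbols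
are tables. The correctness proof sends a word to its value at an element beta
of L with beta^d = nu(beta), and shows that sums and products of words have the
right values. A short certificate supplies the rest. The computation x^(p^d) = x
shows that x^d - nu divides X^(p^d) - X, whence beta exists in L
([modulus_root]); an inverse of the product of the x^(p^i) - x shows that beta
has d distinct conjugates, whence reduced words with a nonzero symbol have
nonzero values ([evv_neq0]); and expressions of the powers of x through the
conjugates of gamma show that the latter span L ([normal_span]). *)

(** * The values at 1 of the Carlitz module *)

Section CarlitzPowers.
Local Open Scope ring_scope.
Variable F : finFieldType.
Local Notation q := #|F|.

Lemma tweval1E (f : twpoly F) : tweval f 1 = (f : {poly {poly F}}).[1].
Proof.
by rewrite /tweval horner_coef; apply: eq_bigr => i _; rewrite !expr1n.
Qed.

Lemma tweval1_wide (f : twpoly F) n : (twsize f <= n)%N ->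
  tweval f 1 = \sum_(i < n) twcoef f i.
Proof.
move=> le_f_n; rewrite tweval1E (horner_coef_wide _ le_f_n).
by apply: eq_bigr => i _; rewrite expr1n mulr1.
Qed.

Definition carlitz_power (n : nat) : {poly F} :=
  tweval (carlitz ('X^n : {poly F})) 1.

Lemma tweval1_twC_mul x (f : twpoly F) : tweval (twC x * f) 1 = x * tweval f 1.
Proof.
pose n := maxn (twsize f) (twsize (twC x * f)).
rewrite !(@tweval1_wide _ n) ?leq_maxl ?leq_maxr // big_distrr /=.
apply: eq_bigr => i _; rewrite twcoef_mul big_ord_recl big1 => [|j _].
  by rewrite addr0 subn0 expn0 expr1 twcoefC.
by rewrite twcoefC /= mul0r.
Qed.

Lemma tweval1_tau_mul (f : twpoly F) : tweval (tau F * f) 1 = tweval f 1 ^+ q.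
Proof.
pose n := maxn (twsize f) (twsize (tau F * f)).
rewrite (@tweval1_wide (tau F * f) n.+1) ?leqW ?leq_maxr //.
rewrite (@tweval1_wide f n) ?leq_maxl // -[X in _ ^+ X](expn1 q) frob_sum.
rewrite big_ord_recl twcoef_mul big_ord1 twcoef_tau mul0r add0r.
apply: eq_bigr => i _; rewrite twcoef_mul /bump /=.
rewrite big_ord_recl twcoef_tau mul0r add0r.
rewrite big_ord_recl twcoef_tau /bump /= mul1r subSS subn0 big1 ?addr0 // => j _.
by rewrite twcoef_tau mul0r.
Qed.

Lemma carlitz_power0 : carlitz_power 0 = 1.
Proof. by rewrite /carlitz_power expr0 rmorph1 tweval1E hornerE. Qed.

Lemma carlitz_powerS n :
  carlitz_power n.+1 = 'X * carlitz_power n + carlitz_power n ^+ q.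
Proof.
rewrite /carlitz_power exprS rmorphM /= carlitzX mulrDl.
rewrite tweval1E [X in X.[1]]/= hornerD -!tweval1E.
by rewrite tweval1_twC_mul tweval1_tau_mul.
Qed.

Lemma tweval1_carlitz (P : {poly F}) :
  tweval (carlitz P) 1 = \sum_(n < size P) P`_n *: carlitz_power n.
Proof.
rewrite -{1}(coefK P) poly_def rmorph_sum /= tweval1E.
rewrite (big_morph (fun f : twpoly F => (f : {poly {poly F}}).[1])
  (fun f g => hornerD f g 1) (horner0 1)).
apply: eq_bigr => n _; rewrite -mul_polyC rmorphM /= /carlitz_power.
have -> : carlitz (P`_n)%:P = twC (P`_n)%:P.
  rewrite /carlitz horner_algC; apply/twpolyP => i.
  by rewrite twcoefZ twcoefC /twcoef coefC; case: (i == 0%N); rewrite ?mulr1 ?mulr0.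
by rewrite -tweval1E tweval1_twC_mul mul_polyC.
Qed.

Lemma natr_card : q%:R = 0 :> F.
Proof.
by have := expg_cardG (in_setT (1 : F)); rewrite cardsT FinRing.zmodXgE.
Qed.

(** The q-th power has derivative zero; only the term 'X C_n contributes. *)
Lemma deriv_carlitz_powerS n :
  (carlitz_power n.+1)^`() = carlitz_power n + 'X * (carlitz_power n)^`().
Proof.
rewrite carlitz_powerS derivD derivM derivX mul1r deriv_exp -mulr_natr.
by rewrite -polyC_natr natr_card polyC0 mulr0 addr0.
Qed.
End CarlitzPowers.

(** * The derivative of rho_P(1) at a root of P *)

Section CoefficientForm.
Local Open Scope ring_scope.
Variable L : fieldType.
Implicit Types (u : nat -> L) (g h : {poly L}).

(** The linear form on polynomials that sends 'X^i to u_i. The value at theta of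
the derivative of rho_P(1) is of this shape, with u_i the value at theta of the
derivative of C_i. *)
Definition coef_form u g : L := \sum_(i < size g) g`_i * u i.

Lemma coef_form_wide n u g : (size g <= n)%N ->
  coef_form u g = \sum_(i < n) g`_i * u i.
Proof.
move=> le_g_n; rewrite /coef_form (big_ord_widen n (fun i => g`_i * u i)) //.
rewrite big_mkcond; apply: eq_bigr => i _; case: ltnP => // le_g_i.
by rewrite nth_default ?mul0r.
Qed.

Lemma coef_formD u g h : coef_form u (g + h) = coef_form u g + coef_form u h.
Proof.
pose n := maxn (size g) (size h).
rewrite !(@coef_form_wide n) ?leq_maxl ?leq_maxr ?size_polyD // -big_split.
by apply: eq_bigr => i _; rewrite coefD mulrDl.
Qed.

Lemma coef_formZ u c g : coef_form u (c *: g) = c * coef_form u g.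
Proof.
rewrite (@coef_form_wide (size g)) ?size_scale_leq // /coef_form big_distrr /=.
by apply: eq_bigr => i _; rewrite coefZ mulrA.
Qed.

(** Multiplying the argument by 'X - x is the same as replacing the sequence u
by u_{i+1} - x u_i: this is how recurrences for u are exploited. *)
Lemma coef_form_XsubC u g x :
  coef_form u (('X - x%:P) * g) = coef_form (fun i => u i.+1 - x * u i) g.
Proof.
rewrite mulrBl mul_polyC coef_formD -scaleNr coef_formZ.
rewrite (@coef_form_wide (size g).+1); last first.
  rewrite mulrC; have [->|/size_mulX->//] := eqVneq g 0.
  by rewrite mul0r size_poly0.
rewrite big_ord_recl coefXM mul0r add0r /coef_form big_distrr -big_split /=.
by apply: eq_bigr => i _; rewrite coefXM /= /bump /=; ring.
Qed.
End CoefficientForm.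

Section RootCriterion.
Local Open Scope ring_scope.
Variables (p : nat) (L : fieldType) (iota : {rmorphism 'F_p -> L}).
Hypothesis p_pr : prime p.
Variable theta : L.

Let pcharL : p \in [pchar L].
Proof. by rewrite (fmorph_pchar iota) pchar_Fp. Qed.
Local Notation frob := (pFrobenius_aut pcharL).
Local Notation conj i := (theta ^+ (p ^ i)).

Definition conj_prod m k : {poly L} := \prod_(m <= j < k) ('X - (conj j)%:P).

Lemma map_frob_conj_prod m k :
  map_poly frob (conj_prod m k) = conj_prod m.+1 k.+1.
Proof.
rewrite rmorph_prod /conj_prod big_add1 /=; apply: eq_bigr => j _.
by rewrite rmorphB /= map_polyX map_polyC /= pFrobenius_autE -exprM expnSr.
Qed.

Let a n : L := (map_poly iota (carlitz_power 'F_p n)).[theta].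
Let b n : L := (map_poly iota (carlitz_power 'F_p n)^`()).[theta].

Let a0 : a 0 = 1.
Proof. by rewrite /a carlitz_power0 rmorph1 hornerE. Qed.

Let aS n : a n.+1 = theta * a n + a n ^+ p.
Proof.
by rewrite /a carlitz_powerS card_Fp // rmorphD rmorphM rmorphXn /= map_polyX !hornerE.
Qed.

Let bS n : b n.+1 = a n + theta * b n.
Proof.
by rewrite /b deriv_carlitz_powerS rmorphD rmorphM /= map_polyX !hornerE.
Qed.

(** The recurrence C_{n+1} = T C_n + C_n^p at T = theta says that a_{n+1} -
theta a_n = a_n^p, so the factor 'X - theta turns the form into a p-th power. *)
Lemma coef_form_frob (g : {poly L}) :
  coef_form a (('X - theta%:P) * map_poly frob g) = coef_form a g ^+ p.
Proof.
rewrite coef_form_XsubC (@coef_form_wide _ (size g)) ?size_poly //.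
rewrite -(pFrobenius_autE pcharL) rmorph_sum /=; apply: eq_bigr => i _.
by rewrite coef_map aS addrAC subrr add0r rmorphM /= !pFrobenius_autE.
Qed.

(** Peeling off 'X - theta leaves the Frobenius image of the shorter product; by
induction the value is a p-th power of 1. *)
Lemma coef_form_conj_prod0 k : coef_form a (conj_prod 0 k) = 1.
Proof.
elim: k => [|k IHk].
  by rewrite /conj_prod big_geq // /coef_form size_poly1 big_ord1 coefC mul1r.
rewrite /conj_prod big_ltn // expn0 expr1 -/(conj_prod 1 k.+1).
by rewrite -map_frob_conj_prod coef_form_frob IHk expr1n.
Qed.

Fixpoint carlitz_horner k : L :=
  if k is k'.+1 then 1 + (theta - conj k) * carlitz_horner k' else 1.

(** The last factor is split as ('X - theta) + (theta - theta^(p^k)): the first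
summand completes the product handled above, the second one is a scalar. *)
Lemma coef_form_conj_prod1 k : coef_form a (conj_prod 1 k.+1) = carlitz_horner k.
Proof.
elim: k => [|k IHk].
  by rewrite /conj_prod big_geq // /coef_form size_poly1 big_ord1 coefC mul1r.
rewrite /conj_prod big_nat_recr //= -/(conj_prod 1 k.+1) mulrC.
have -> : 'X - (conj k.+1)%:P = ('X - theta%:P) + (theta - conj k.+1)%:P.
  by rewrite polyCB addrA subrK.
rewrite mulrDl coef_formD mul_polyC coef_formZ IHk; congr (_ + _).
by rewrite -map_frob_conj_prod coef_form_frob coef_form_conj_prod0 expr1n.
Qed.

(** P^2 divides rho_P(1) - 1, so the derivative of the latter vanishes at theta;
the recurrence for derivatives turns it into the form [coef_form a] applied to
the product of the ('X - theta^(p^j)) with 0 < j. *)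
Lemma wieferich_carlitz_horner d (P : {poly 'F_p}) :
  map_poly iota P = conj_prod 0 d.+1 -> c_wieferich P -> carlitz_horner d = 0.
Proof.
move=> facP [_ _ /dvdpP[Q defQ]].
have theta_root : (map_poly iota P).[theta] = 0.
  by rewrite facP /conj_prod big_ltn // hornerM expn0 expr1 hornerXsubC subrr mul0r.
have: (map_poly iota (tweval (carlitz P) 1)^`()).[theta] = 0.
  rewrite -(subrK 1 (tweval _ _)) defQ derivD derivC addr0 derivM deriv_exp.
  rewrite expr1 !(rmorphD, rmorphM, rmorphMn, rmorphXn) /= !hornerE.
  by rewrite theta_root ?(mulr0, addr0) /= ?mulr0 ?addr0.
rewrite tweval1_carlitz raddf_sum rmorph_sum horner_sum /=.
have -> : \sum_(i < size P) (map_poly iota (P`_i *: carlitz_power _ i)^`()).[theta]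
    = coef_form b (map_poly iota P).
  rewrite /coef_form size_map_poly; apply: eq_bigr => i _.
  by rewrite derivZ map_polyZ /= hornerZ coef_map.
(* The factor 'X - theta turns b into b_{i+1} - theta b_i = a_i. *)
rewrite facP /conj_prod big_ltn // expn0 expr1 coef_form_XsubC.
rewrite -coef_form_conj_prod1 /conj_prod => <-.
by apply: eq_bigr => i _; rewrite bS addrK.
Qed.
End RootCriterion.

(** * Conjugates in a finite field *)

Section Conjugates.
Local Open Scope ring_scope.
Variables (p d : nat) (L : finFieldType) (iota : {rmorphism 'F_p -> L}).
Hypotheses (p_pr : prime p) (cardL : #|L| = (p ^ d)%N).
Implicit Types (x y : L) (g : {poly 'F_p}).

Let pcharL : p \in [pchar L].
Proof. by rewrite (fmorph_pchar iota) pchar_Fp. Qed.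

Lemma expf_pD m x y : (x + y) ^+ (p ^ m) = x ^+ (p ^ m) + y ^+ (p ^ m).
Proof. by apply: exprDn_pchar; rewrite pnatX pnatE // pcharL. Qed.

Lemma expf_pB m x y : (x - y) ^+ (p ^ m) = x ^+ (p ^ m) - y ^+ (p ^ m).
Proof. by apply: (addIr (y ^+ (p ^ m))); rewrite -expf_pD !subrK. Qed.

Lemma expf_p_inj m : injective (fun x => x ^+ (p ^ m)).
Proof.
move=> x y /= eq_xy; apply/eqP; rewrite -subr_eq0.
have: (x - y) ^+ (p ^ m) == 0 by rewrite expf_pB eq_xy subrr.
by rewrite expf_eq0 => /andP[].
Qed.

Lemma iota_expf_p m (c : 'F_p) : iota c ^+ (p ^ m) = iota c.
Proof.
rewrite -rmorphXn; congr (iota _); elim: m => [|m IHm]; first by rewrite expr1.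
by rewrite expnS exprM -[X in c ^+ X](card_Fp p_pr) expf_card.
Qed.

Lemma horner_expf_p m g x :
  (map_poly iota g).[x] ^+ (p ^ m) = (map_poly iota g).[x ^+ (p ^ m)].
Proof.
elim/poly_ind: g => [|g c IHg].
  by rewrite rmorph0 !horner0 expr0n expn_eq0 eqn0Ngt prime_gt0.
rewrite rmorphD rmorphM /= map_polyX map_polyC /= !hornerE.
by rewrite expf_pD exprMn IHg iota_expf_p.
Qed.

Definition conj_seq x := [seq x ^+ (p ^ i) | i <- seq.iota 0 d].

Lemma conj_uniq x :
  (forall m, (0 < m < d)%N -> x ^+ (p ^ m) != x) -> uniq (conj_seq x).
Proof.
move=> x_gen; rewrite map_inj_in_uniq ?iota_uniq // => i j.
rewrite !mem_iota !add0n /= => lt_i_d lt_j_d.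
wlog lt_ij: i j lt_i_d lt_j_d / (i < j)%N => [Hw eq_ij|].
  by case: (ltngtP i j) => // [lt|lt]; [apply: Hw | apply/esym/Hw].
rewrite -(subnK (ltnW lt_ij)) expnD exprM => /expf_p_inj/esym/eqP x_fix.
have := x_gen (j - i)%N; rewrite x_fix subn_gt0 lt_ij.
by rewrite (leq_ltn_trans (leq_subr _ _) lt_j_d) => /(_ isT).
Qed.

(** A polynomial over F_p that vanishes at x vanishes at all conjugates of x,
and there are too many of them. *)
Lemma horner_conj_eq0 g x : uniq (conj_seq x) -> (size g <= d)%N ->
  (map_poly iota g).[x] = 0 -> g = 0.
Proof.
move=> uniq_x le_g_d gx0; apply/eqP; rewrite -(map_poly_eq0 iota).
apply: contraTT le_g_d => nz_g.
rewrite -ltnNge -(size_map_poly iota).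
have := max_poly_roots nz_g _ uniq_x; rewrite size_map size_iota; apply.
apply/allP => _ /mapP[i _ ->]; rewrite rootE -horner_expf_p gx0.
by rewrite expr0n expn_eq0 eqn0Ngt prime_gt0.
Qed.

(** Evaluation at x is injective on polynomials of degree less than d, and there
are as many of these as elements of L. *)
Lemma horner_conj_onto x y : uniq (conj_seq x) ->
  exists2 g : {poly 'F_p}, (size g <= d)%N & y = (map_poly iota g).[x].
Proof.
move=> uniq_x; pose f (g : {poly_d 'F_p}) : L := (map_poly iota g).[x].
have f_inj : injective f.
  move=> g h eq_fgh; apply/val_inj/eqP; rewrite -subr_eq0; apply/eqP.
  apply: (horner_conj_eq0 uniq_x).
    by rewrite (leq_trans (size_polyD _ _)) // size_polyN geq_max !size_npoly.
  by rewrite rmorphB hornerD hornerN; apply/eqP; rewrite subr_eq0; apply/eqP.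
have le_card : (#|L| <= #|{poly_d 'F_p}|)%N by rewrite card_npoly cardL card_Fp.
have /codomP[g ->] := inj_card_onto f_inj le_card y.
by exists g; rewrite ?size_npoly.
Qed.

Section Generator.
Variable theta : L.
Hypothesis theta_gen : forall y, exists g, y = (map_poly iota g).[theta].

(** If theta were fixed by a smaller power of Frobenius, so would be everything
that it generates, and 'X^(p^m) - 'X would have p^d roots. *)
Lemma gen_conj_uniq : uniq (conj_seq theta).
Proof.
apply: conj_uniq => m /andP[m_gt0 lt_m_d]; apply/eqP => theta_fix.
pose r : {poly L} := 'X^(p ^ m) - 'X.
have pm_gt1 : (1 < p ^ m)%N by rewrite -(expn0 p) ltn_exp2l ?prime_gt1.
have size_r : size r = (p ^ m).+1.
  by rewrite size_polyDl size_polyXn // size_polyN size_polyX ltnS.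
have nz_r : r != 0 by rewrite -size_poly_eq0 size_r.
have all_fix : all (root r) (enum L).
  apply/allP => y _; have [g ->] := theta_gen y.
  by rewrite rootE /r hornerD hornerN hornerXn hornerX horner_expf_p theta_fix subrr.
have := max_poly_roots nz_r all_fix (enum_uniq L).
by rewrite -cardE cardL size_r ltnS leq_exp2l ?prime_gt1 // leqNgt lt_m_d.
Qed.

Lemma gen_conj_factor (P : {poly 'F_p}) : P \is monic -> size P = d.+1 ->
  (map_poly iota P).[theta] = 0 ->
  map_poly iota P = \prod_(0 <= j < d) ('X - (theta ^+ (p ^ j))%:P).
Proof.
move=> monP sizeP root_theta.
have := @all_roots_prod_XsubC _ (map_poly iota P) (conj_seq theta).
rewrite size_map_poly size_map size_iota sizeP => /(_ erefl) ->.
- rewrite lead_coef_map (monicP monP) rmorph1 scale1r big_map.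
  by rewrite /index_iota subn0.
- apply/allP => _ /mapP[i _ ->]; rewrite rootE -horner_expf_p root_theta.
  by rewrite expr0n expn_eq0 eqn0Ngt prime_gt0.
- by rewrite uniq_rootsE gen_conj_uniq.
Qed.
End Generator.
End Conjugates.

(** * Symbols *)

(** A symbol codes k consecutive coefficients modulo p by the number with these
digits in base p. The exponent k is 4 for p = 3, 3 for p = 5, 2 for p = 7 and 1
for larger p; the largest value of p^k is 5^3 = 125. With one constructor for
each code, a table lookup is a single case distinction. *)
Inductive sym :=
  | s0 | s1 | s2 | s3 | s4 | s5 | s6 | s7 | s8 | s9 | s10 | s11 | s12 | s13
  | s14 | s15 | s16 | s17 | s18 | s19 | s20 | s21 | s22 | s23 | s24 | s25
  | s26 | s27 | s28 | s29 | s30 | s31 | s32 | s33 | s34 | s35 | s36 | s37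
  | s38 | s39 | s40 | s41 | s42 | s43 | s44 | s45 | s46 | s47 | s48 | s49
  | s50 | s51 | s52 | s53 | s54 | s55 | s56 | s57 | s58 | s59 | s60 | s61
  | s62 | s63 | s64 | s65 | s66 | s67 | s68 | s69 | s70 | s71 | s72 | s73
  | s74 | s75 | s76 | s77 | s78 | s79 | s80 | s81 | s82 | s83 | s84 | s85
  | s86 | s87 | s88 | s89 | s90 | s91 | s92 | s93 | s94 | s95 | s96 | s97
  | s98 | s99 | s100 | s101 | s102 | s103 | s104 | s105 | s106 | s107 | s108
  | s109 | s110 | s111 | s112 | s113 | s114 | s115 | s116 | s117 | s118 | s119
  | s120 | s121 | s122 | s123 | s124.

Definition sym_case (T : Type) (f : sym -> T) (a : sym) : T :=
  match a with
  | s0 => f s0 | s1 => f s1 | s2 => f s2 | s3 => f s3 | s4 => f s4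
  | s5 => f s5 | s6 => f s6 | s7 => f s7 | s8 => f s8 | s9 => f s9
  | s10 => f s10 | s11 => f s11 | s12 => f s12 | s13 => f s13 | s14 => f s14
  | s15 => f s15 | s16 => f s16 | s17 => f s17 | s18 => f s18 | s19 => f s19
  | s20 => f s20 | s21 => f s21 | s22 => f s22 | s23 => f s23 | s24 => f s24
  | s25 => f s25 | s26 => f s26 | s27 => f s27 | s28 => f s28 | s29 => f s29
  | s30 => f s30 | s31 => f s31 | s32 => f s32 | s33 => f s33 | s34 => f s34
  | s35 => f s35 | s36 => f s36 | s37 => f s37 | s38 => f s38 | s39 => f s39
  | s40 => f s40 | s41 => f s41 | s42 => f s42 | s43 => f s43 | s44 => f s44
  | s45 => f s45 | s46 => f s46 | s47 => f s47 | s48 => f s48 | s49 => f s49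
  | s50 => f s50 | s51 => f s51 | s52 => f s52 | s53 => f s53 | s54 => f s54
  | s55 => f s55 | s56 => f s56 | s57 => f s57 | s58 => f s58 | s59 => f s59
  | s60 => f s60 | s61 => f s61 | s62 => f s62 | s63 => f s63 | s64 => f s64
  | s65 => f s65 | s66 => f s66 | s67 => f s67 | s68 => f s68 | s69 => f s69
  | s70 => f s70 | s71 => f s71 | s72 => f s72 | s73 => f s73 | s74 => f s74
  | s75 => f s75 | s76 => f s76 | s77 => f s77 | s78 => f s78 | s79 => f s79
  | s80 => f s80 | s81 => f s81 | s82 => f s82 | s83 => f s83 | s84 => f s84
  | s85 => f s85 | s86 => f s86 | s87 => f s87 | s88 => f s88 | s89 => f s89
  | s90 => f s90 | s91 => f s91 | s92 => f s92 | s93 => f s93 | s94 => f s94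
  | s95 => f s95 | s96 => f s96 | s97 => f s97 | s98 => f s98 | s99 => f s99
  | s100 => f s100 | s101 => f s101 | s102 => f s102 | s103 => f s103
  | s104 => f s104 | s105 => f s105 | s106 => f s106 | s107 => f s107
  | s108 => f s108 | s109 => f s109 | s110 => f s110 | s111 => f s111
  | s112 => f s112 | s113 => f s113 | s114 => f s114 | s115 => f s115
  | s116 => f s116 | s117 => f s117 | s118 => f s118 | s119 => f s119
  | s120 => f s120 | s121 => f s121 | s122 => f s122 | s123 => f s123
  | s124 => f s124
  end.

Definition syms : seq sym := [::
  s0; s1; s2; s3; s4; s5; s6; s7; s8; s9; s10; s11; s12; s13; s14; s15; s16;
  s17; s18; s19; s20; s21; s22; s23; s24; s25; s26; s27; s28; s29; s30; s31;
  s32; s33; s34; s35; s36; s37; s38; s39; s40; s41; s42; s43; s44; s45; s46;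
  s47; s48; s49; s50; s51; s52; s53; s54; s55; s56; s57; s58; s59; s60; s61;
  s62; s63; s64; s65; s66; s67; s68; s69; s70; s71; s72; s73; s74; s75; s76;
  s77; s78; s79; s80; s81; s82; s83; s84; s85; s86; s87; s88; s89; s90; s91;
  s92; s93; s94; s95; s96; s97; s98; s99; s100; s101; s102; s103; s104; s105;
  s106; s107; s108; s109; s110; s111; s112; s113; s114; s115; s116; s117;
  s118; s119; s120; s121; s122; s123; s124].

Definition idx (a : sym) : nat :=
  match a with
  | s0 => 0 | s1 => 1 | s2 => 2 | s3 => 3 | s4 => 4 | s5 => 5 | s6 => 6
  | s7 => 7 | s8 => 8 | s9 => 9 | s10 => 10 | s11 => 11 | s12 => 12
  | s13 => 13 | s14 => 14 | s15 => 15 | s16 => 16 | s17 => 17 | s18 => 18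
  | s19 => 19 | s20 => 20 | s21 => 21 | s22 => 22 | s23 => 23 | s24 => 24
  | s25 => 25 | s26 => 26 | s27 => 27 | s28 => 28 | s29 => 29 | s30 => 30
  | s31 => 31 | s32 => 32 | s33 => 33 | s34 => 34 | s35 => 35 | s36 => 36
  | s37 => 37 | s38 => 38 | s39 => 39 | s40 => 40 | s41 => 41 | s42 => 42
  | s43 => 43 | s44 => 44 | s45 => 45 | s46 => 46 | s47 => 47 | s48 => 48
  | s49 => 49 | s50 => 50 | s51 => 51 | s52 => 52 | s53 => 53 | s54 => 54
  | s55 => 55 | s56 => 56 | s57 => 57 | s58 => 58 | s59 => 59 | s60 => 60
  | s61 => 61 | s62 => 62 | s63 => 63 | s64 => 64 | s65 => 65 | s66 => 66
  | s67 => 67 | s68 => 68 | s69 => 69 | s70 => 70 | s71 => 71 | s72 => 72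
  | s73 => 73 | s74 => 74 | s75 => 75 | s76 => 76 | s77 => 77 | s78 => 78
  | s79 => 79 | s80 => 80 | s81 => 81 | s82 => 82 | s83 => 83 | s84 => 84
  | s85 => 85 | s86 => 86 | s87 => 87 | s88 => 88 | s89 => 89 | s90 => 90
  | s91 => 91 | s92 => 92 | s93 => 93 | s94 => 94 | s95 => 95 | s96 => 96
  | s97 => 97 | s98 => 98 | s99 => 99 | s100 => 100 | s101 => 101
  | s102 => 102 | s103 => 103 | s104 => 104 | s105 => 105 | s106 => 106
  | s107 => 107 | s108 => 108 | s109 => 109 | s110 => 110 | s111 => 111
  | s112 => 112 | s113 => 113 | s114 => 114 | s115 => 115 | s116 => 116
  | s117 => 117 | s118 => 118 | s119 => 119 | s120 => 120 | s121 => 121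
  | s122 => 122 | s123 => 123 | s124 => 124
  end.

Definition sy (n : nat) : sym := nth s0 syms n.

(** Evaluating these replaces a function by its table. *)
Definition tab1 (T : Type) (f : sym -> T) : sym -> T := fun a => sym_case f a.
Definition tab2 (T : Type) (f : sym -> sym -> T) : sym -> sym -> T :=
  fun a b => sym_case (fun a' => sym_case (f a') b) a.

Definition cmp : sym -> sym -> comparison := Eval vm_compute in
  tab2 (fun a b => if idx a < idx b then Lt
                   else if idx a == idx b then Eq else Gt).

(** * Digit lists *)

Fixpoint digits (p k n : nat) : seq nat :=
  if k is k'.+1 then n %% p :: digits p k' (n %/ p) else [::].
Definition undigits (p : nat) (l : seq nat) : nat :=
  foldr (fun a n => a + p * n) 0 l.

Fixpoint addl (p : nat) (l m : seq nat) : seq nat :=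
  match l, m with
  | a :: l', b :: m' => (a + b) %% p :: addl p l' m'
  | [::], _ => m
  | _, [::] => l
  end.
Definition scalel (p c : nat) (l : seq nat) : seq nat :=
  [seq (c * a) %% p | a <- l].
Definition mull (p : nat) (l m : seq nat) : seq nat :=
  foldr (fun a r => addl p (scalel p a m) (0 :: r)) [::] l.

(** Multiplication by x modulo x^d - nu, where nbs lists the coefficients of
nu. *)
Definition mulXl (p d : nat) (nbs r : seq nat) : seq nat :=
  addl p (0 :: take d.-1 r) (scalel p (nth 0 r d.-1) nbs).
Definition modl (p d : nat) (nbs l : seq nat) : seq nat :=
  foldr (fun a r => addl p [:: a] (mulXl p d nbs r)) (nseq d 0) l.

(** * Symbol tables *)

(** Here [dg] decodes a symbol into its k digits. The product of two polynomials
with k coefficients has 2k - 1 of them: [lo] codes the first k and [hi] the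
others. The inverse table [inv] is for constants. *)
Record tables := Tables {
  dg : sym -> seq nat;
  ad : sym -> sym -> sym;
  lo : sym -> sym -> sym;
  hi : sym -> sym -> sym;
  inv : sym -> sym;
  nz : sym -> bool }.

(** Codes that are not less than p^k are decoded as zero, so that the properties
in [tables_ok] hold for all symbols without exception. *)
Definition make_tables (p k : nat) : tables :=
  let dig a := if idx a < p ^ k then digits p k (idx a) else nseq k 0 in
  let ofl l := sy (undigits p l) in
  Tables (tab1 dig)
    (tab2 (fun a b => ofl (addl p (dig a) (dig b))))
    (tab2 (fun a b => ofl (take k (mull p (dig a) (dig b)))))
    (tab2 (fun a b => ofl (drop k (mull p (dig a) (dig b)))))
    (tab1 (fun a =>
       sy (find (fun n => (n * idx a) %% p == 1) (iota 0 p))))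
    (tab1 (fun a => has (fun x => x != 0) (dig a))).

(** The last three conditions are about the symbols of the constants. *)
Definition tables_ok (p k : nat) (T : tables) : bool :=
  let ls := iota 0 p in
  [&& p <= size syms,
      all (fun a => let l := dg T a in
        [&& size l == k, all (fun x => x < p) l,
            nz T a == has (fun x => x != 0) l &
            all (fun b => let m := dg T b in
              (dg T (ad T a b) == addl p l m) &&
              (dg T (lo T a b) ++ dg T (hi T a b) == rcons (mull p l m) 0))
              syms]) syms,
      all (fun c => (dg T (sy c) == c :: nseq k.-1 0) &&
                    all (fun a => dg T (lo T (sy c) a) == scalel p c (dg T a)) syms)
        ls,
      all (fun a => all (fun b => (idx (ad T (sy a) (sy b)) == (a + b) %% p) &&
                                  (idx (lo T (sy a) (sy b)) == (a * b) %% p))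
                        ls) ls &
      all (fun a => (0 < idx (inv T (sy a)) < p) &&
                    (idx (lo T (inv T (sy a)) (sy a)) == 1)) (behead ls)].

(** * Arithmetic on words of symbols *)

Section Vectors.
Variables (ad lo hi : sym -> sym -> sym) (k : nat).
Fixpoint addv (u v : seq sym) : seq sym :=
  match u, v with
  | a :: u', b :: v' => ad a b :: addv u' v'
  | [::], _ => v
  | _, [::] => u
  end.
Definition scalev (c : sym) (v : seq sym) : seq sym := [seq lo c a | a <- v].

(** The high half of each product of symbols is carried into the next
position. *)
Fixpoint mulsv_carry (a c : sym) (v : seq sym) : seq sym :=
  if v is b :: v' then ad (lo a b) c :: mulsv_carry a (hi a b) v'
  else [:: c].
Definition mulsv (a : sym) (v : seq sym) : seq sym :=
  if k == 1 then scalev a v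
  else if v is b :: v' then lo a b :: mulsv_carry a (hi a b) v' else [::].
Fixpoint convv (u v : seq sym) : seq sym :=
  if u is a :: u' then
    if mulsv a v is e :: es then e :: addv es (convv u' v)
    else s0 :: convv u' v
  else [::].
Definition horner_sym (c : sym) (col : seq sym) : sym :=
  foldr (fun s acc => ad s (lo c acc)) s0 col.

(** The entry a of row i is the reduced word for the polynomial that has the
digits of the symbol a at the position i. A word is reduced by keeping its first
d %/ k symbols, which have degree less than d, and adding to them the rows of
all the others; the symbol at position d %/ k may straddle the degree d. *)
Variables (d : nat) (rows : seq (seq (seq sym))).
Definition nblocks := (d + k.-1) %/ k.
Definition red_entry i j a := nth s0 (nth [::] (nth [::] rows i) (idx a)) j.

(** Reduction modulo a sparse polynomial leaves many columns of the rows zero;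
these additions are omitted. *)
Definition red_zero i j := all (fun a => idx (red_entry i j a) == 0) syms.
Fixpoint add_row (i j : nat) (x : sym) (acc : seq sym) : seq sym :=
  if acc is y :: acc' then
    (if red_zero i j then y else ad y (sym_case (red_entry i j) x))
      :: add_row i j.+1 x acc'
  else [::].
Fixpoint add_rows (i : nat) (v acc : seq sym) : seq sym :=
  if v is x :: v' then add_rows i.+1 v' (add_row i 0 x acc) else acc.
Definition redv (v : seq sym) : seq sym :=
  add_rows (d %/ k) (drop (d %/ k) v)
    (take (d %/ k) v ++ nseq (nblocks - d %/ k) s0).
End Vectors.

Fixpoint chunks (p k n : nat) (l : seq nat) : seq sym :=
  if n is n'.+1 then sy (undigits p (take k l)) :: chunks p k n' (drop k l)
  else [::].
Definition make_rows (p k d : nat) (nbs : seq nat) : seq (seq (seq sym)) :=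
  [seq [seq chunks p k (nblocks k d)
             (modl p d nbs (nseq (k * i) 0 ++ digits p k n))
       | n <- iota 0 (p ^ k)] | i <- iota 0 (nblocks k d).*2].

(** Equal to f on words of length n ([unrollE]), and x0 elsewhere. For a fixed
n, evaluating [unroll x0 n f] under its binders runs all the recursion of f on a
word of n variables. What is left is a nest of table lookups without loops: this
is how each pair (d, p) gets its own code for addition, multiplication and
evaluation. *)
Fixpoint unroll (T : Type) (x0 : T) (n : nat) (f : seq sym -> T)
    (v : seq sym) : T :=
  match n, v with
  | n'.+1, a :: v' => unroll x0 n' (fun w => f (a :: w)) v'
  | 0, [::] => f [::]
  | _, _ => x0
  end.

Definition conv_spec k d ad lo hi u v :=
  unroll [::] (nblocks k d)
    (fun u' => unroll [::] (nblocks k d) (convv ad lo hi k u') v) u.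

(** A product of two words has twice their length, or one symbol less if there
are no carries. *)
Definition red_spec k d rows ad v :=
  unroll [::] ((nblocks k d).*2 - (k == 1)) (redv ad k d rows) v.
Definition add_spec k d ad u v :=
  unroll [::] (nblocks k d)
    (fun u' => unroll [::] (nblocks k d) (addv ad u') v) u.
Definition horner_spec d ad lo c col := unroll s0 d (horner_sym ad lo c) col.

(** * The search *)

(** Unlike [all] and [has], these stop at the first decisive item also under
call by value. *)
Fixpoint allb (A : Type) (f : A -> bool) (l : seq A) : bool :=
  if l is x :: l' then (if f x then allb f l' else false) else true.
Fixpoint hasb (A : Type) (f : A -> bool) (l : seq A) : bool :=
  if l is x :: l' then (if f x then true else hasb f l') else false.

Section Search.
Variables (ad lo : sym -> sym -> sym) (inv : sym -> sym) (nz : sym -> bool).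
Variables (addf mulf : seq sym -> seq sym -> seq sym).
Variables (horner : sym -> seq sym -> sym).
Variables (one : seq sym) (cs : seq sym).

(** A pointer (c, i) stands for a rotation of the word whose first i letters
have been read: multiplied by c, they equal the first i letters of the word. The
factor is not yet determined, which is coded by None, while these letters are
all zero. *)
Definition ptr := (option sym * nat)%type.

(** Reads the letter a. A pointer whose next letter is larger than that of the
prefix u is dropped for good. If it is smaller then u does not begin a canonical
word, and the branch is closed with the answer true. An undetermined factor is
fixed by the first nonzero letter, which is normalised to 1. The surviving
pointers go to the continuation K. *)
Fixpoint step (u : seq sym) (a : sym) (ps acc : seq ptr) (K : seq ptr -> bool)
    : bool :=
  if ps is p :: ps' then
    let x := if p.1 is Some c then lo c a else if nz a then s1 else s0 in
    match cmp x (nth s0 u p.2) with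
    | Lt => true
    | Gt => step u a ps' acc K
    | Eq =>
        let c := if p.1 is Some c then Some c
                 else if nz a then Some (inv a) else None in
        step u a ps' ((c, p.2.+1) :: acc) K
    end
  else K acc.

(** Reads the word a second time, to complete the comparison with the rotations
that wrap around. Beyond the end of u the default letter is zero, the smallest
one, so a pointer that has come full circle closes no branch. *)
Fixpoint cyc (u w : seq sym) (ps : seq ptr) (K : bool) : bool :=
  if ps is [::] then K else
  if w is a :: w' then step u a ps [::] (fun ps' => cyc u w' ps' K) else K.
Fixpoint prods (m : seq sym) (zs : seq (seq sym)) : seq (seq sym) :=
  if zs is z :: zs' then m :: prods (mulf m z) zs' else [:: m].

(** The words zs are S_{d-1}(z), ..., S_1(z). As E(cz) is the sum of the c^i m_i
with m_i the product of the first i of them, its symbol at each position b is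
obtained from the symbols of the m_i at b; one nonzero symbol suffices, and with
few exceptions it is found at the first position. *)
Definition leaf (zs : seq (seq sym)) : bool :=
  if zs is z :: zs' then
    let ms := one :: prods z zs' in
    let cols := [seq [seq nth s0 m b | m <- ms] | b <- iota 0 (size one)] in
    allb (fun c => hasb (fun col => nz (horner c col)) cols) cs
  else false.
Fixpoint addvs (us vs : seq (seq sym)) : seq (seq sym) :=
  match us, vs with
  | u :: us', v :: vs' => addf u v :: addvs us' vs'
  | _, _ => [::]
  end.

(** A letter at a given position of the word, with its contributions to the
S_j(z). *)
Definition entry := (sym * seq (seq sym))%type.

(** The argument s is the sum of the letters read and zs are the partial sums of
the S_j(z). At the last position only the letter that makes the sum zero is
retained. *)
Fixpoint search (gss : seq (seq entry)) (glast : seq entry)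
    (u : seq sym) (ps : seq ptr) (s : sym) (zs : seq (seq sym)) : bool :=
  if gss is g :: gss' then
    allb (fun e => let a := e.1 in
      step u a ((None, 0) :: ps) [::] (fun ps' =>
        search gss' glast (rcons u a) ps' (ad s a) (addvs zs e.2))) g
  else
    allb (fun e => let a := e.1 in if nz (ad s a) then true else
      step u a ((None, 0) :: ps) [::] (fun ps' =>
        let u' := rcons u a in cyc u' u' ps' (leaf (addvs zs e.2)))) glast.

(** In a canonical word the first nonzero letter is 1. It is not at the last
position, for then the sum would not be zero. *)
Fixpoint start (gss : seq (seq entry)) (glast : seq entry) (u : seq sym)
    : bool :=
  if gss is g :: gss' then
    if search gss' glast (rcons u s1) [::] s1 (nth (s0, [::]) g 1).2 then
      start gss' glast (rcons u s0)
    else false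
  else true.
End Search.

(** * Certificates *)

(** The operations conv, red, add and horner are parameters: for each pair (d,
p) they are the loop-free forms of [conv_spec], [red_spec], [add_spec] and
[horner_spec]. Their first arguments are the tables, which thereby stay
variables while the loops are evaluated. *)
Section Certificate.
Variables (p k d : nat) (T : tables) (nbs : seq nat).
Variable rows : seq (seq (seq sym)).
Local Notation op := (sym -> sym -> sym).
Variables (conv : op -> op -> op -> seq sym -> seq sym -> seq sym).
Variables (red : op -> seq sym -> seq sym).
Variables (add : op -> seq sym -> seq sym -> seq sym).
Variables (horner : op -> op -> sym -> seq sym -> sym).
Variables (disc_inv gam : seq sym) (basis : seq (seq nat)).

Let nb := nblocks k d.
Let mulf u v := red (ad T) (conv (ad T) (lo T) (hi T) u v).
Let addf := add (ad T).
Let scale := scalev (lo T).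

Definition digv (v : seq sym) : seq nat := flatten (map (dg T) v).

(** A reduced word represents a polynomial of degree less than d: the digits
that fill up the last symbol are zero. *)
Definition wf (v : seq sym) : bool :=
  (size v == nb) && all (fun x => x == 0) (drop d (digv v)).
Definition eqv (u v : seq sym) : bool := map idx u == map idx v.
Definition enc_ok (l : seq nat) (v : seq sym) : bool :=
  wf v && (digv v == l ++ nseq (nb * k - size l) 0).
Definition rows_ok : bool :=
  all (fun i => all (fun a =>
    enc_ok (modl p d nbs (nseq (k * i) 0 ++ dg T a))
           [seq red_entry rows i j a | j <- iota 0 nb]) syms)
    (iota 0 nb.*2).
Definition powv (v : seq sym) : seq sym := iter p.-1 (mulf v) v.
Definition sumv (vs : seq (seq sym)) : seq sym := foldr addf (nseq nb s0) vs.
Definition lincomb (c : seq nat) (vs : seq (seq sym)) : seq sym :=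
  sumv [seq scale (sy x.1) x.2 | x <- zip c vs].
Definition xpow (j : nat) : seq sym := chunks p k nb (nseq j 0 ++ [:: 1]).

(** The equalities say in order: x^(p^d) = x; the product of disc_inv and of the
x^(p^i) - x with 0 < i < d is 1; gamma has trace 1; row j of the matrix basis
expresses x^j through the conjugates of gamma. *)
Definition cert_ok : bool :=
  let cx := traject powv (xpow 1) d in
  let cg := traject powv gam d in
  [&& 0 < k, 1 < d, size nbs == d, rows_ok,
      all (fun j => enc_ok (nseq j 0 ++ [:: 1]) (xpow j)) (iota 0 d),
      wf disc_inv, wf gam,
      eqv (powv (last [::] cx)) (xpow 1),
      eqv (foldr (fun y acc =>
             mulf (addf y (scale (sy p.-1) (xpow 1))) acc)
             disc_inv (behead cx)) (xpow 0),
      eqv (sumv cg) (xpow 0) &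
      all (fun j => let r := nth [::] basis j in
        [&& size r == d, all (fun c => c < p) r & eqv (lincomb r cg) (xpow j)])
        (iota 0 d)].

(** The contributions a S_j(gamma^(p^t)) of a letter a at position t, for j from
d - 1 down to 1; cg lists the conjugates of gamma. *)
Definition gtable (cg : seq (seq sym)) (t : nat) : seq entry :=
  let base := [seq sumv [seq nth [::] cg ((t + l) %% d) | l <- iota 0 j]
              | j <- rev (iota 1 d.-1)] in
  [seq (sy a, [seq scale (sy a) v | v <- base]) | a <- iota 0 p].

(** The tables are taken apart once, outside of the search. *)
Definition search_ok : bool :=
  let: Tables _ ad0 lo0 hi0 inv0 nz0 := T in
  let cg := traject powv gam d in
  let gs := [seq gtable cg t | t <- iota 0 d] in
  start ad0 lo0 inv0 nz0 (add ad0)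
    (fun u v => red ad0 (conv ad0 lo0 hi0 u v)) (horner ad0 lo0)
    (xpow 0) [seq sy c | c <- iota 1 p.-1] (take d.-1 gs) (last [::] gs) [::].
End Certificate.

Local Notation op := (sym -> sym -> sym).

(** * Symbols, digit lists and their values *)

Lemma idxK : cancel idx sy.
Proof. by case. Qed.

Lemma syK n : n < size syms -> idx (sy n) = n.
Proof.
have: all (fun n => idx (sy n) == n) (iota 0 (size syms)) by vm_compute.
by move=> /allP h lt_n; apply/eqP/h; rewrite mem_iota.
Qed.

Lemma sym_caseE (A : Type) (f : sym -> A) a : sym_case f a = f a.
Proof. by case: a. Qed.

Lemma all_symsP (f : sym -> bool) : reflect (forall a, f a) (all f syms).
Proof.
apply: (iffP idP) => [all_f a|fT]; last by apply/(all_nthP s0) => i _; apply: fT.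
by rewrite -(idxK a); apply: (elimT (all_nthP s0) all_f); case: a.
Qed.

Lemma cmpE a b :
  cmp a b = if idx a < idx b then Lt else if idx a == idx b then Eq else Gt.
Proof.
have: all (fun a => all (fun b =>
  match cmp a b, (if idx a < idx b then Lt else if idx a == idx b then Eq else Gt) with
  Lt, Lt | Eq, Eq | Gt, Gt => true | _, _ => false end) syms) syms by vm_compute.
by move=> /all_symsP/(_ a)/all_symsP/(_ b); case: (cmp a b); case: ifP => //; case: ifP.
Qed.

Lemma eqvP u v : eqv u v -> u = v.
Proof. by move/eqP/(inj_map (can_inj idxK)). Qed.

Lemma allb_nth (A : Type) (f : A -> bool) x0 l i :
  allb f l -> i < size l -> f (nth x0 l i).
Proof. by elim: l i => //= x l IHl [|i]; case: (f x) => // /IHl; apply. Qed.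

Lemma hasb_nth (A : Type) (f : A -> bool) x0 l :
  hasb f l -> exists2 i, i < size l & f (nth x0 l i).
Proof.
elim: l => //= x l IHl; have [f_x _|_] := boolP (f x); first by exists 0.
by case/IHl=> i lt_i f_i; exists i.+1.
Qed.

Lemma unrollE (A : Type) (x0 : A) n f v : size v = n -> unroll x0 n f v = f v.
Proof. by move=> <-; elim: v f => //= a v IHv f; rewrite IHv. Qed.

Section DigitLists.
Variables (p : nat) (S : comNzRingType) (beta : S).
Hypothesis pS : (p%:R = 0 :> S)%R.
Local Open Scope ring_scope.

Definition ev (l : seq nat) : S := foldr (fun a y => a%:R + beta * y) 0 l.

Lemma natr_mod n : (n %% p)%:R = n%:R :> S.
Proof. by rewrite {2}(divn_eq n p) natrD natrM pS mulr0 add0r. Qed.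

Lemma ev_cat l m : ev (l ++ m) = ev l + beta ^+ size l * ev m.
Proof.
elim: l => [|a l IHl] /=; first by rewrite mul1r add0r.
by rewrite IHl exprS; ring.
Qed.

Lemma ev_nseq0 n : ev (nseq n 0%N) = 0.
Proof. by elim: n => //= n ->; rewrite mulr0 addr0. Qed.

Lemma ev_addl l m : ev (addl p l m) = ev l + ev m.
Proof.
elim: l m => [|a l IHl] [|b m] //=; rewrite ?add0r ?addr0 //.
by rewrite natr_mod natrD IHl; ring.
Qed.

Lemma ev_scalel c l : ev (scalel p c l) = c%:R * ev l.
Proof.
elim: l => [|a l IHl] /=; first by rewrite mulr0.
by rewrite natr_mod natrM IHl; ring.
Qed.

Lemma ev_mull l m : ev (mull p l m) = ev l * ev m.
Proof.
elim: l => [|a l IHl] /=; first by rewrite mul0r.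
by rewrite ev_addl ev_scalel /= IHl; ring.
Qed.

Lemma size_addl l m : size (addl p l m) = maxn (size l) (size m).
Proof.
by elim: l m => [|a l IHl] [|b m] //=; rewrite ?maxn0 // IHl maxnSS.
Qed.

Section Modulus.
Variables (d : nat) (nbs : seq nat).
Hypotheses (d_gt0 : (0 < d)%N) (size_nbs : size nbs = d).
Hypothesis beta_root : beta ^+ d = ev nbs.

Lemma size_mulXl r : size r = d -> size (mulXl p d nbs r) = d.
Proof.
move=> size_r; rewrite size_addl size_map /= size_takel ?size_nbs ?prednK //.
  by rewrite maxnn.
by rewrite size_r leq_pred.
Qed.

Lemma modl_cons a l :
  modl p d nbs (a :: l) = addl p [:: a] (mulXl p d nbs (modl p d nbs l)).
Proof. by []. Qed.

Lemma size_modl l : size (modl p d nbs l) = d.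
Proof.
elim: l => [|a l IHl]; first by rewrite size_nseq.
by rewrite modl_cons size_addl size_mulXl //; apply/maxn_idPr.
Qed.

Lemma ev_mulXl r : size r = d -> ev (mulXl p d nbs r) = beta * ev r.
Proof.
move=> size_r; rewrite ev_addl ev_scalel /= add0r -beta_root.
have lt_d1 : (d.-1 < size r)%N by rewrite size_r prednK.
rewrite -[in RHS](cat_take_drop d.-1 r) ev_cat (drop_nth 0%N lt_d1) /=.
rewrite size_takel ?size_r ?leq_pred // drop_oversize ?size_r ?prednK //=.
rewrite mulr0 addr0; have -> : beta ^+ d = beta * beta ^+ d.-1 by rewrite -exprS prednK.
by ring.
Qed.

Lemma ev_modl l : ev (modl p d nbs l) = ev l.
Proof.
elim: l => [|a l IHl]; first exact: ev_nseq0.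
by rewrite modl_cons ev_addl ev_mulXl ?size_modl // IHl /= mulr0 addr0.
Qed.
End Modulus.
End DigitLists.

(** * Values of symbols and words *)

Section TableFacts.
Variables (p k : nat) (T : tables).
Hypotheses (p_gt0 : 0 < p) (T_ok : tables_ok p k T).

Lemma leq_p_syms : p <= size syms.
Proof. by case/and5P: T_ok. Qed.

Lemma syK_p c : c < p -> idx (sy c) = c.
Proof. by move=> lt_c; rewrite syK // (leq_trans lt_c leq_p_syms). Qed.

Lemma size_dg a : size (dg T a) = k.
Proof.
by case/and5P: T_ok => _ /all_symsP/(_ a) /and4P[/eqP].
Qed.

Lemma dg_lt a : all (fun x => x < p) (dg T a).
Proof. by case/and5P: T_ok => _ /all_symsP/(_ a) /and4P[]. Qed.

Lemma nzE a : nz T a = has (fun x => x != 0) (dg T a).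
Proof. by case/and5P: T_ok => _ /all_symsP/(_ a) /and4P[_ _ /eqP]. Qed.

Lemma dg_ad a b : dg T (ad T a b) = addl p (dg T a) (dg T b).
Proof.
by case/and5P: T_ok => _ /all_symsP/(_ a) /and4P[_ _ _ /all_symsP/(_ b)/andP[/eqP]].
Qed.

Lemma dg_lo_hi a b :
  dg T (lo T a b) ++ dg T (hi T a b) = rcons (mull p (dg T a) (dg T b)) 0.
Proof.
by case/and5P: T_ok => _ /all_symsP/(_ a) /and4P[_ _ _ /all_symsP/(_ b)/andP[_ /eqP]].
Qed.

Lemma dg_sy c : c < p -> dg T (sy c) = c :: nseq k.-1 0.
Proof.
move=> lt_c; case/and5P: T_ok => _ _ /allP/(_ c); rewrite mem_iota lt_c.
by move=> /(_ isT)/andP[/eqP].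
Qed.

Lemma dg_scale c a : c < p -> dg T (lo T (sy c) a) = scalel p c (dg T a).
Proof.
move=> lt_c; case/and5P: T_ok => _ _ /allP/(_ c); rewrite mem_iota lt_c.
by move=> /(_ isT)/andP[_ /all_symsP/(_ a)/eqP].
Qed.

Lemma ad_sy a b : a < p -> b < p -> ad T (sy a) (sy b) = sy ((a + b) %% p).
Proof.
move=> lt_a lt_b; case/and5P: T_ok => _ _ _ /allP/(_ a); rewrite mem_iota lt_a.
move=> /(_ isT)/allP/(_ b); rewrite mem_iota lt_b => /(_ isT)/andP[/eqP ad_ab _].
by rewrite -ad_ab idxK.
Qed.

Lemma lo_sy a b : a < p -> b < p -> lo T (sy a) (sy b) = sy ((a * b) %% p).
Proof.
move=> lt_a lt_b; case/and5P: T_ok => _ _ _ /allP/(_ a); rewrite mem_iota lt_a.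
move=> /(_ isT)/allP/(_ b); rewrite mem_iota lt_b => /(_ isT)/andP[_ /eqP lo_ab].
by rewrite -lo_ab idxK.
Qed.

Lemma inv_sy a : 0 < a < p ->
  0 < idx (inv T (sy a)) < p /\ (idx (inv T (sy a)) * a) %% p = 1.
Proof.
case/andP=> a_gt0 lt_a; case/and5P: T_ok => _ _ _ _ /allP/(_ a).
have loE := lo_sy; have -> : behead (iota 0 p) = iota 1 p.-1 by case: p p_gt0.
rewrite mem_iota a_gt0 add1n prednK //.
rewrite lt_a => /(_ isT)/andP[inv_a /eqP lo_inv]; split=> //.
case/andP: (inv_a) => _ lt_inv; have := loE _ _ lt_inv lt_a.
by rewrite idxK => lo_eq; rewrite -lo_inv lo_eq syK_p // ltn_mod.
Qed.

Lemma nz_sy c : c < p -> nz T (sy c) = (c != 0).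
Proof. by move=> lt_c; rewrite nzE dg_sy //= has_nseq andbF orbF. Qed.

Section Values.
Variables (S : comNzRingType) (beta : S).
Hypothesis pS : (p%:R = 0 :> S)%R.
Hypothesis k_gt0 : 0 < k.
Local Open Scope ring_scope.

Definition eval_sym (a : sym) : S := ev beta (dg T a).
Definition eval_vec (v : seq sym) : S := ev beta (digv T v).

Local Notation evs := eval_sym.
Local Notation evv := eval_vec.

Lemma evv_cons a v : evv (a :: v) = evs a + beta ^+ k * evv v.
Proof. by rewrite /eval_vec /digv /= ev_cat size_dg. Qed.

Lemma evs_ad a b : evs (ad T a b) = evs a + evs b.
Proof. by rewrite /eval_sym dg_ad ev_addl. Qed.

Lemma evs_lo_hi a b : evs (lo T a b) + beta ^+ k * evs (hi T a b) = evs a * evs b.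
Proof.
rewrite /eval_sym -{1}(size_dg (lo T a b)) -ev_cat dg_lo_hi.
by rewrite -cats1 ev_cat ev_mull //= mulr0 addr0 mulr0 addr0.
Qed.

Lemma evs_sy c : (c < p)%N -> evs (sy c) = c%:R.
Proof. by move=> lt_c; rewrite /eval_sym dg_sy //= ev_nseq0 mulr0 addr0. Qed.

Lemma evs0 : evs s0 = 0.
Proof. by rewrite -[s0]/(sy 0) evs_sy. Qed.

Lemma evs_scale c a : (c < p)%N -> evs (lo T (sy c) a) = c%:R * evs a.
Proof. by move=> lt_c; rewrite /eval_sym dg_scale // ev_scalel. Qed.

Lemma evv_cat u v : evv (u ++ v) = evv u + beta ^+ (k * size u) * evv v.
Proof.
elim: u => [|a u IHu]; first by rewrite muln0 expr0 /eval_vec /= add0r mul1r.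
by rewrite cat_cons !evv_cons IHu mulnS exprD; ring.
Qed.

Lemma evv_nseq0 n : evv (nseq n s0) = 0.
Proof. by elim: n => //= n IHn; rewrite evv_cons evs0 IHn mulr0 addr0. Qed.

Lemma evv_addv u v : evv (addv (ad T) u v) = evv u + evv v.
Proof.
elim: u v => [|a u IHu] [|b v] /=; rewrite ?add0r ?addr0 //.
by rewrite !evv_cons evs_ad IHu; ring.
Qed.

Lemma evv_scalev c v : (c < p)%N -> evv (scalev (lo T) (sy c) v) = c%:R * evv v.
Proof.
move=> lt_c; elim: v => [|a v IHv]; first by rewrite /eval_vec /= mulr0.
by rewrite [scalev _ _ _]/= !evv_cons evs_scale // IHv; ring.
Qed.

Lemma evv_mulsv_carry a c v :
  evv (mulsv_carry (ad T) (lo T) (hi T) a c v) = evs c + evs a * evv v.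
Proof.
elim: v c => [|b v IHv] c /=; first by rewrite evv_cons /eval_vec /=; ring.
rewrite !evv_cons evs_ad IHv [in RHS]mulrDr.
have -> : evs a * evs b = evs (lo T a b) + beta ^+ k * evs (hi T a b).
  by rewrite evs_lo_hi.
by ring.
Qed.

(** With one digit per symbol the high halves vanish, which is why [mulsv] can
do without carries. *)
Lemma evs_lo1 a b : k = 1%N -> evs (lo T a b) = evs a * evs b.
Proof.
move=> k1; rewrite -evs_lo_hi.
suff -> : evs (hi T a b) = 0 by rewrite mulr0 addr0.
have := dg_lo_hi a b; rewrite /eval_sym.
have := size_dg a; have := size_dg b.
have := size_dg (lo T a b); have := size_dg (hi T a b); rewrite k1.
case: (dg T a) (dg T b) => [|x []] // [|y []] //.
case: (dg T (hi T a b)) (dg T (lo T a b)) => [|z []] // [|t []] //= _ _ _ _.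
by case=> _ ->; rewrite mulr0 addr0.
Qed.

Lemma evv_mulsv a v :
  evv (mulsv (ad T) (lo T) (hi T) k a v) = evs a * evv v.
Proof.
rewrite /mulsv; case: eqP => [k1|_].
  elim: v => [|b v IHv]; first by rewrite /eval_vec /= mulr0.
  by rewrite [scalev _ _ _]/= !evv_cons evs_lo1 // IHv; ring.
case: v => [|b v]; first by rewrite /eval_vec /= mulr0.
rewrite !evv_cons evv_mulsv_carry [in RHS]mulrDr.
have -> : evs a * evs b = evs (lo T a b) + beta ^+ k * evs (hi T a b).
  by rewrite evs_lo_hi.
by ring.
Qed.

Lemma evv_convv u v :
  evv (convv (ad T) (lo T) (hi T) k u v) = evv u * evv v.
Proof.
elim: u => [|a u IHu]; first by rewrite /eval_vec /= mul0r.
rewrite [convv _ _ _ _ _ _]/=; have := evv_mulsv a v.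
rewrite [evv (a :: u)]evv_cons mulrDl.
case: mulsv => [|e es] <-; rewrite !evv_cons.
  by rewrite IHu evs0 /eval_vec /=; ring.
by rewrite evv_addv IHu; ring.
Qed.
End Values.

Section Sizes.
Hypothesis k_gt0 : 0 < k.

Lemma size_addv u v : size (addv (ad T) u v) = maxn (size u) (size v).
Proof.
by elim: u v => [|a u IHu] [|b v] //=; rewrite ?maxn0 // IHu maxnSS.
Qed.

Lemma size_mulsv a v : 0 < size v ->
  size (mulsv (ad T) (lo T) (hi T) k a v) = size v + (k != 1).
Proof.
rewrite /mulsv; case: eqP => _ /=; first by rewrite size_map addn0.
case: v => //= b v _; rewrite addn1; congr _.+1.
by elim: v (hi T a b) => //= c v IHv x; rewrite IHv.
Qed.

Lemma size_convv u v : 0 < size u -> 0 < size v ->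
  size (convv (ad T) (lo T) (hi T) k u v) = (size u + size v).-1 + (k != 1).
Proof.
move=> u_gt0 v_gt0; case: u u_gt0 => // a u _.
elim: u a => [|b u IHu] a; rewrite [convv _ _ _ _ _ _]/=; have := size_mulsv a v_gt0.
  case: mulsv => [|e es] /= size_ab; first by rewrite -size_ab in v_gt0 *; lia.
  by rewrite size_addv maxn0; lia.
case: mulsv => [|e es] /= size_ab; first by lia.
by rewrite size_addv IHu /=; lia.
Qed.

Lemma size_digv v : size (digv T v) = k * size v.
Proof. by elim: v => [|a v IHv] /=; rewrite ?muln0 // size_cat size_dg IHv mulnS. Qed.

Lemma digv_cat u v : digv T (u ++ v) = digv T u ++ digv T v.
Proof. by rewrite /digv map_cat flatten_cat. Qed.

Lemma digv_nseq0 n : digv T (nseq n s0) = nseq (k * n) 0.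
Proof.
elim: n => [|n IHn]; first by rewrite muln0.
rewrite [LHS]/(dg T s0 ++ digv T (nseq n s0)) IHn -[s0]/(sy 0) dg_sy // mulnS.
by rewrite nseqD; case: k k_gt0.
Qed.

Lemma nth_addl n l m : nth 0 l n = 0 -> nth 0 m n = 0 -> nth 0 (addl p l m) n = 0.
Proof.
elim: l m n => [|a l IHl] [|b m] [|n] //=; last exact: IHl.
by move=> -> ->; rewrite mod0n.
Qed.

Lemma nth_digv_addv n u v : nth 0 (digv T u) n = 0 -> nth 0 (digv T v) n = 0 ->
  nth 0 (digv T (addv (ad T) u v)) n = 0.
Proof.
elim: u v n => [|a u IHu] [|b v] n //=.
rewrite !nth_cat !size_dg; case: ifP => _; last exact: IHu.
by rewrite dg_ad; exact: nth_addl.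
Qed.

Lemma nth_digv_scalev n c v : c < p -> nth 0 (digv T v) n = 0 ->
  nth 0 (digv T (scalev (lo T) (sy c) v)) n = 0.
Proof.
move=> lt_c; elim: v n => [|a v IHv] n //=.
rewrite !nth_cat !size_dg; case: ifP => lt_n; last exact: IHv.
move=> a_n; rewrite dg_scale // (nth_map 0) ?size_dg //.
by rewrite a_n muln0 mod0n.
Qed.
End Sizes.
End TableFacts.

(** * Arithmetic of reduced words *)

Section VectorArithmetic.
Variables (p k d : nat) (T : tables) (nbs : seq nat).
Variable rows : seq (seq (seq sym)).
Variables (conv : op -> op -> op -> seq sym -> seq sym -> seq sym).
Variables (red : op -> seq sym -> seq sym).
Variables (add : op -> seq sym -> seq sym -> seq sym).
Hypotheses (p_gt0 : 0 < p) (T_ok : tables_ok p k T) (k_gt0 : 0 < k).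
Hypothesis d_gt0 : 0 < d.
Hypothesis size_nbs : size nbs = d.
Hypothesis rows_okT : rows_ok p k d T nbs rows.
Hypothesis convE : forall ad lo hi u v,
  conv ad lo hi u v = conv_spec k d ad lo hi u v.
Hypothesis redE : forall ad v, red ad v = red_spec k d rows ad v.
Hypothesis addE : forall ad u v, add ad u v = add_spec k d ad u v.

Let nb := nblocks k d.
Let mulf u v := red (ad T) (conv (ad T) (lo T) (hi T) u v).
Local Notation addf := (add (ad T)).
Local Notation scale := (scalev (lo T)).
Local Notation wf := (wf k d T).

Lemma nblocks_gt0 : 0 < nb.
Proof. by rewrite divn_gt0 //; lia. Qed.

Lemma leq_low_nblocks : d %/ k <= nb.
Proof. by rewrite leq_div2r // leq_addr. Qed.

Lemma wfP v :
  reflect (size v = nb /\ forall n, d <= n -> nth 0 (digv T v) n = 0) (wf v).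
Proof.
apply: (iffP andP) => [[/eqP size_v /(all_nthP 0) zero_v]|[-> zero_v]].
  split=> // n le_dn; have [lt_n|le_n] := ltnP n (size (digv T v)).
    have := zero_v (n - d); rewrite size_drop nth_drop subnKC // => /(_ _)/eqP.
    by apply; rewrite ltn_sub2r // (leq_ltn_trans le_dn).
  by rewrite nth_default.
by split=> //; apply/(all_nthP 0) => n _; rewrite nth_drop zero_v ?leq_addr.
Qed.

Lemma wf_size v : wf v -> size v = nb.
Proof. by case/wfP. Qed.

Lemma wf_zeros : wf (nseq nb s0).
Proof.
apply/wfP; rewrite size_nseq; split=> // n _.
by rewrite (digv_nseq0 p_gt0 T_ok) ?nth_nseq ?if_same.
Qed.

Lemma wf_scale c v : c < p -> wf v -> wf (scale (sy c) v).
Proof.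
move=> lt_c /wfP[size_v zero_v]; apply/wfP; rewrite size_map; split=> // n le_dn.
by apply: (nth_digv_scalev T_ok) => //; apply: zero_v.
Qed.

Lemma addfE u v : wf u -> wf v -> addf u v = addv (ad T) u v.
Proof.
move=> /wf_size size_u /wf_size size_v.
by rewrite addE /add_spec !unrollE.
Qed.

Lemma wf_add u v : wf u -> wf v -> wf (addf u v).
Proof.
move=> wf_u wf_v; rewrite addfE //.
case/wfP: wf_u wf_v => size_u zero_u /wfP[size_v zero_v]; apply/wfP.
rewrite size_addv size_u size_v maxnn; split=> // n le_dn.
by apply: (nth_digv_addv T_ok); [apply: zero_u | apply: zero_v].
Qed.

Let row i x := [seq red_entry rows i j x | j <- iota 0 nb].

Lemma row_ok i x : i < nb.*2 ->
  wf (row i x) /\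
  digv T (row i x) = modl p d nbs (nseq (k * i) 0 ++ dg T x) ++ nseq (nb * k - d) 0.
Proof.
move=> lt_i; have /allP/(_ i) := rows_okT; rewrite mem_iota lt_i => /(_ isT).
by move=> /all_symsP/(_ x)/andP[wf_r /eqP ->]; rewrite size_modl.
Qed.

Lemma red_zeroP i j x : red_zero rows i j -> red_entry rows i j x = s0.
Proof. by move=> /all_symsP/(_ x)/eqP idx0; rewrite -[LHS]idxK idx0. Qed.

Lemma size_add_row i j x acc : size (add_row (ad T) rows i j x acc) = size acc.
Proof. by elim: acc j => //= a acc IHacc j; rewrite IHacc. Qed.

Lemma nth_digv_add_row i j x acc n :
  nth 0 (digv T acc) n = 0 ->
  nth 0 (digv T [seq red_entry rows i j' x | j' <- iota j (size acc)]) n = 0 ->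
  nth 0 (digv T (add_row (ad T) rows i j x acc)) n = 0.
Proof.
elim: acc j n => //= a acc IHacc j n.
rewrite !nth_cat !(size_dg T_ok); case: ifP => lt_n; last exact: IHacc.
case: ifP => // _; rewrite sym_caseE (dg_ad T_ok); exact: nth_addl.
Qed.

Lemma wf_add_row i x acc : i < nb.*2 -> wf acc ->
  wf (add_row (ad T) rows i 0 x acc).
Proof.
move=> lt_i /wfP[size_acc zero_acc]; apply/wfP.
rewrite size_add_row size_acc; split=> // n le_dn.
apply: nth_digv_add_row; first exact: zero_acc.
by rewrite size_acc; have [/wfP[_ ->]] := row_ok x lt_i.
Qed.

Lemma wf_add_rows i v acc : i + size v <= nb.*2 -> wf acc ->
  wf (add_rows (ad T) rows i v acc).
Proof.
elim: v i acc => //= x v IHv i acc le_i wf_acc; apply: IHv; first by lia.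
by apply: wf_add_row => //; lia.
Qed.

Lemma leq_low_d : k * (d %/ k) <= d.
Proof. by rewrite mulnC leq_divM. Qed.

Lemma wf_low v : nb <= size v ->
  wf (take (d %/ k) v ++ nseq (nb - d %/ k) s0).
Proof.
move=> le_v; have := leq_low_nblocks => le_low.
have size_low : size (take (d %/ k) v) = d %/ k.
  by rewrite size_takel // (leq_trans le_low).
apply/wfP; rewrite size_cat size_nseq size_low subnKC //; split=> // n le_dn.
rewrite digv_cat nth_cat (size_digv T_ok) size_low.
rewrite ltnNge (leq_trans leq_low_d le_dn) /=.
by rewrite (digv_nseq0 p_gt0 T_ok) // nth_nseq if_same.
Qed.

Lemma wf_red v : nb <= size v <= nb.*2 -> wf (redv (ad T) k d rows v).
Proof.
case/andP=> le_v ge_v; apply: wf_add_rows; last exact: wf_low.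
by rewrite size_drop subnKC // (leq_trans leq_low_nblocks).
Qed.

Lemma mulfE u v : wf u -> wf v ->
  let c := convv (ad T) (lo T) (hi T) k u v in
  mulf u v = redv (ad T) k d rows c /\ nb <= size c <= nb.*2.
Proof.
move=> /wf_size size_u /wf_size size_v; have nb_gt0 := nblocks_gt0.
have size_c : size (convv (ad T) (lo T) (hi T) k u v) = nb.*2 - (k == 1).
  rewrite (size_convv p_gt0 T_ok k_gt0) ?size_u ?size_v //.
  by case: (k == 1) => /=; lia.
rewrite /= size_c; split; last by case: (k == 1); lia.
by rewrite /mulf redE convE /conv_spec !unrollE // /red_spec unrollE.
Qed.

Lemma wf_mul u v : wf u -> wf v -> wf (mulf u v).
Proof. by move=> wf_u wf_v; have [-> ] := mulfE wf_u wf_v; apply: wf_red. Qed.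

Section Values.
Variables (S : comNzRingType) (beta : S).
Hypothesis pS : (p%:R = 0 :> S)%R.
Hypothesis beta_root : (beta ^+ d = ev beta nbs)%R.
Local Open Scope ring_scope.
Local Notation evv := (eval_vec T beta).
Local Notation evs := (eval_sym T beta).

Lemma evv_add u v : wf u -> wf v -> evv (addf u v) = evv u + evv v.
Proof. by move=> wf_u wf_v; rewrite addfE // (evv_addv T_ok). Qed.

Lemma evv_row i x : (i < nb.*2)%N -> evv (row i x) = beta ^+ (k * i) * evs x.
Proof.
move=> /(row_ok x)[_ digv_r]; rewrite /eval_vec digv_r ev_cat ev_nseq0 mulr0 addr0.
by rewrite (ev_modl pS) // ev_cat ev_nseq0 add0r size_nseq.
Qed.

Lemma evv_add_row i j x acc :
  evv (add_row (ad T) rows i j x acc) =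
    evv acc + evv [seq red_entry rows i j' x | j' <- iota j (size acc)].
Proof.
elim: acc j => [|a acc IHacc] j /=; first by rewrite /eval_vec /= addr0.
rewrite !(evv_cons T_ok) IHacc; case: ifP => [/red_zeroP->|_].
  by rewrite (evs0 p_gt0 T_ok); ring.
by rewrite sym_caseE (evs_ad T_ok) //; ring.
Qed.

Lemma evv_add_rows i v acc : (i + size v <= nb.*2)%N -> size acc = nb ->
  evv (add_rows (ad T) rows i v acc) = evv acc + beta ^+ (k * i) * evv v.
Proof.
elim: v i acc => [|x v IHv] i acc /= le_i size_acc.
  by rewrite [X in _ * X]/eval_vec /= mulr0 addr0.
rewrite IHv ?size_add_row //; last by lia.
rewrite evv_add_row size_acc evv_row ?(evv_cons T_ok); last by lia.
by rewrite mulnS exprD; ring.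
Qed.

Lemma evv_red v : (nb <= size v <= nb.*2)%N -> evv (redv (ad T) k d rows v) = evv v.
Proof.
case/andP=> le_v ge_v; have le_low := leq_low_nblocks.
rewrite evv_add_rows; first last.
- by apply/wf_size/wf_low.
- by rewrite size_drop subnKC // (leq_trans le_low).
rewrite -[in RHS](cat_take_drop (d %/ k) v) !(evv_cat T_ok) (evv_nseq0 p_gt0 T_ok).
by rewrite size_takel ?(leq_trans le_low) // mulr0 addr0.
Qed.

Lemma evv_mul u v : wf u -> wf v -> evv (mulf u v) = evv u * evv v.
Proof.
move=> wf_u wf_v; have [-> size_c] := mulfE wf_u wf_v.
by rewrite evv_red // (evv_convv p_gt0 T_ok).
Qed.

Lemma evv_enc l v : enc_ok k d T l v -> evv v = ev beta l.
Proof.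
by case/andP=> _ /eqP; rewrite /eval_vec => ->; rewrite ev_cat ev_nseq0 mulr0 addr0.
Qed.

End Values.
End VectorArithmetic.

(** * Canonical words *)

Section CanonicalWords.
Variables (p d : nat).
Hypotheses (p_gt0 : 0 < p) (d_gt0 : 0 < d).

Definition letter (w : seq nat) (n : nat) : nat := nth 0 w (n %% d).

(** Minimality among the rotations of the multiples of w, in the form in
which the search tests it: where such a rotation first differs from w, it is
larger. *)
Definition canonical (w : seq nat) : Prop := forall c j i, 0 < c < p -> i < d ->
  (forall n, n < i -> (c * letter w (j + n)) %% p = letter w n) ->
  letter w i <= (c * letter w (j + i)) %% p.

Definition turn (c j : nat) (w : seq nat) : seq nat :=
  mkseq (fun n => (c * letter w (j + n)) %% p) d.

Lemma letter_turn c j w n : letter (turn c j w) n = (c * letter w (j + n)) %% p.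
Proof. by rewrite {1}/letter nth_mkseq ?ltn_mod // /letter modnDmr. Qed.

(** For lists of digits of equal length, the lexicographic order is the order of
these numbers. *)
Fixpoint radix (l : seq nat) : nat :=
  if l is a :: l' then a * p ^ size l' + radix l' else 0.

Lemma radix_lt l : all (fun a => a < p) l -> radix l < p ^ size l.
Proof.
elim: l => //= a l IHl /andP[lt_a /IHl lt_l].
rewrite expnS; apply: (@leq_trans (a.+1 * p ^ size l)).
  by rewrite mulSn addnC ltn_add2r.
by rewrite leq_mul2r lt_a orbT.
Qed.

Lemma ltn_radix i l m : size l = size m -> i < size l ->
  all (fun a => a < p) l ->
  (forall n, n < i -> nth 0 l n = nth 0 m n) -> nth 0 l i < nth 0 m i ->
  radix l < radix m.
Proof.
elim: i l m => [|i IHi] [|a l] [|b m] //= [size_lm].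
  move=> _ /andP[_ /radix_lt lt_l] _ lt_ab; rewrite -size_lm.
  apply: (@leq_trans (a.+1 * p ^ size l)); first by rewrite mulSn addnC ltn_add2r.
  by rewrite (leq_trans _ (leq_addr _ _)) // leq_mul2r lt_ab orbT.
rewrite ltnS => lt_i /andP[_ l_lt] eq_lm lt_lm.
have /= -> := eq_lm 0 isT; rewrite size_lm ltn_add2l; apply: IHi => // n lt_n.
exact: (eq_lm n.+1).
Qed.

(** The multiple and rotation of least [radix] works: multiplying and rotating
it further leads to another candidate of the same family. *)
Lemma exists_canonical (w : seq nat) : prime p ->
  exists c j, [/\ 0 < c < p, j < d & canonical (turn c j w)].
Proof.
move=> p_pr; have p_gt1 := prime_gt1 p_pr.
pose P (x : 'I_p * 'I_d) := 0 < x.1.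
pose f (x : 'I_p * 'I_d) := radix (turn x.1 x.2 w).
pose x0 := (Ordinal p_gt1, Ordinal d_gt0).
have Px0 : P x0 by [].
case: (arg_minnP f Px0) => -[c j] /= c_gt0 min_cj.
exists c, j; split; rewrite ?ltn_ord ?andbT // => c' j' i /andP[c'_gt0 lt_c'] lt_i eq_i.
rewrite leqNgt; apply/negP => lt_wi.
have cc_lt : (c' * c) %% p < p by rewrite ltn_mod.
have cc_gt0 : 0 < (c' * c) %% p.
  rewrite lt0n -/(p %| _) Euclid_dvdM // negb_or !gtnNdvd //.
have jj_lt : (j' + j) %% d < d by rewrite ltn_mod.
(* Factors multiply and rotations add, so this candidate would be smaller. *)
have := min_cj (Ordinal cc_lt, Ordinal jj_lt) cc_gt0; rewrite leqNgt => /negP; apply.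
have letter_cj n : letter (turn ((c' * c) %% p) ((j' + j) %% d) w) n =
    (c' * letter (turn c j w) (j' + n)) %% p.
  rewrite !letter_turn modnMmr modnMml -mulnA; congr (((_ * (_ * _))) %% _).
  by rewrite /letter -modnDml modn_mod modnDml; congr (nth _ _ (_ %% _)); lia.
have nthE v n : size v = d -> n < d -> nth 0 v n = letter v n.
  by move=> size_v lt_n; rewrite /letter modn_small.
apply: (@ltn_radix i); rewrite ?size_mkseq //.
- by apply/allP => _ /mapP[n _ ->]; rewrite ltn_mod.
- move=> n lt_n; rewrite !nthE ?size_mkseq // ?(ltn_trans lt_n) //.
  by rewrite letter_cj eq_i.
by rewrite !nthE ?size_mkseq // letter_cj.
Qed.

End CanonicalWords.

(** * Soundness of the search *)

(** Fix a canonical word w. The search never closes the branch of a prefix of w,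
so it must succeed at the leaf that belongs to w. *)
Section SearchSoundness.
Variables (p k d : nat) (T : tables).
Hypotheses (p_gt1 : 1 < p) (T_ok : tables_ok p k T).
Hypothesis d_gt1 : 1 < d.
Variable w : seq nat.
Hypotheses (size_w : size w = d) (w_lt : all (fun a => a < p) w).
Hypothesis w_canonical : canonical p d w.

Let p_gt0 : 0 < p := ltnW p_gt1.
Let d_gt0 : 0 < d := ltnW d_gt1.
Local Notation W := (letter d w).

Lemma W_lt n : W n < p.
Proof. by apply: (all_nthP 0 w_lt); rewrite size_w ltn_mod. Qed.

Lemma idx_W n : idx (sy (W n)) = W n.
Proof. by rewrite (syK_p T_ok) // W_lt. Qed.

(** What a pointer (c, i) asserts once t letters have been read, with indices
modulo d. Nothing is asserted about pointers that have come full circle. *)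
Definition valid (t : nat) (q : ptr) : Prop := q.2 < d -> q.2 < t /\
  if q.1 is Some c then exists2 c', 0 < c' < p /\ c = sy c' &
    forall n, n < q.2 -> (c' * W (t - q.2 + n)) %% p = W n
  else forall n, n < q.2 -> W (t - q.2 + n) = 0 /\ W n = 0.

Fixpoint all_valid (t : nat) (ps : seq ptr) : Prop :=
  if ps is q :: ps' then valid t q /\ all_valid t ps' else True.

(** Stated as one equation, with the trivial case for the letters from t to
d, so that a single rewriting covers pointers inside the word and beyond its
end. *)
Definition prefix_upto (t : nat) (u : seq sym) : Prop :=
  forall i, nth s0 u i =
    if i < d then (if i < t then sy (W i) else nth s0 u i) else s0.

(** The comparison never comes out smaller, as the pointer describes a rotation
of a multiple of the canonical word w. For an undetermined factor this is
applied with factor 1 if the letter read is zero, and with its inverse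
otherwise. *)
Lemma step_sound u t ps acc K : prefix_upto t u ->
  all_valid t ps -> all_valid t.+1 acc ->
  step (lo T) (inv T) (nz T) u (sy (W t)) ps acc K ->
  exists2 ps', all_valid t.+1 ps' & K ps'.
Proof.
move=> u_w; elim: ps acc => [|[oc i] ps IHps] acc /=; first by exists acc.
case=> val_q val_ps val_acc; rewrite cmpE u_w.
have [lt_i|le_i] := ltnP i d; last first.
  rewrite ltn0; case: ifP => _; last exact: IHps.
  by apply: IHps => //; split=> //; rewrite /valid /= => lt_i1; lia.
have [/= lt_it val_oc] := val_q lt_i; rewrite lt_it idx_W.
have W_t : W t = W (t - i + i) by rewrite subnK // ltnW.
case: oc val_oc {val_q} => [c|].
  case=> c' [c'_p ->] eq_n; case/andP: (c'_p) => _ lt_c'.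
  rewrite (lo_sy T_ok) ?W_lt // (syK_p T_ok) ?ltn_mod //.
  have := w_canonical c'_p lt_i eq_n; rewrite -W_t leqNgt => /negbTE ->.
  case: eqP => eq_i; last exact: IHps.
  apply: IHps => //; split=> // _ /=; rewrite subSS; split; first by lia.
  exists c' => // n; rewrite ltnS leq_eqVlt => /predU1P[->|/eq_n //].
  by rewrite -W_t.
move=> eq_n; rewrite (nz_sy T_ok) ?W_lt //.
have [W_t0|W_tn0] := eqVneq (W t) 0; rewrite /=.
  have W_i0 : W i = 0.
    apply/eqP; rewrite -leqn0.
    have := @w_canonical 1 (t - i) i; rewrite -W_t W_t0 muln0 mod0n; apply=> //.
    by move=> n /eq_n[-> ->]; rewrite muln0 mod0n.
  rewrite W_i0 /=; apply: IHps => //; split=> // _ /=; rewrite subSS.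
  split; first by lia.
  by move=> n; rewrite ltnS leq_eqVlt => /predU1P[->|/eq_n //]; rewrite -W_t.
have Wt_p : 0 < W t < p by rewrite lt0n W_tn0 W_lt.
have [inv_p inv_W] := inv_sy p_gt0 T_ok Wt_p.
have eq_inv n : n < i -> (idx (inv T (sy (W t))) * W (t - i + n)) %% p = W n.
  by move=> /eq_n[-> ->]; rewrite muln0 mod0n.
have := w_canonical inv_p lt_i eq_inv; rewrite -W_t inv_W leqNgt => /negbTE ->.
case: eqP => eq_i; last exact: IHps.
apply: IHps => //; split=> // _ /=; rewrite subSS; split; first by lia.
exists (idx (inv T (sy (W t)))); first by rewrite idxK.
by move=> n; rewrite ltnS leq_eqVlt => /predU1P[->|/eq_inv //]; rewrite -W_t inv_W.
Qed.

Lemma cyc_sound u v t ps K : prefix_upto t u -> d <= t ->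
  v = [seq sy (W (t + n)) | n <- iota 0 (size v)] ->
  all_valid t ps -> cyc (lo T) (inv T) (nz T) u v ps K -> K.
Proof.
elim: v t ps => [|a v IHv] t ps u_w le_t; first by case: ps.
case=> -> def_v; case: ps => // q ps val_ps /=; rewrite addn0.
case/(step_sound u_w val_ps) => // ps' val_ps'.
apply: (IHv t.+1) => //.
- move=> i; have := u_w i; case: ltnP => // lt_i.
  by rewrite (leq_trans lt_i le_t) (leq_trans lt_i (leqW le_t)).
- by lia.
rewrite {1}def_v -[1]addn0 iotaDl -map_comp; apply: eq_map => n /=.
by rewrite addnA addn1.
Qed.

End SearchSoundness.

Section SearchValues.
Variables (p k d : nat) (T : tables) (nbs : seq nat).
Variable rows : seq (seq (seq sym)).
Variables (conv : op -> op -> op -> seq sym -> seq sym -> seq sym).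
Variables (red : op -> seq sym -> seq sym).
Variables (add : op -> seq sym -> seq sym -> seq sym).
Variables (horner : op -> op -> sym -> seq sym -> sym).
Variable gam : seq sym.
Hypotheses (p_gt1 : 1 < p) (T_ok : tables_ok p k T) (k_gt0 : 0 < k).
Hypotheses (d_gt1 : 1 < d) (size_nbs : size nbs = d).
Hypothesis rows_okT : rows_ok p k d T nbs rows.
Hypothesis convE : forall ad lo hi u v,
  conv ad lo hi u v = conv_spec k d ad lo hi u v.
Hypothesis redE : forall ad v, red ad v = red_spec k d rows ad v.
Hypothesis addE : forall ad u v, add ad u v = add_spec k d ad u v.
Hypothesis hornerE : forall ad lo c col,
  horner ad lo c col = horner_spec d ad lo c col.

Let p_gt0 : 0 < p := ltnW p_gt1.
Let d_gt0 : 0 < d := ltnW d_gt1.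
Let nb := nblocks k d.
Let mulf u v := red (ad T) (conv (ad T) (lo T) (hi T) u v).
Local Notation addf := (add (ad T)).
Local Notation scale := (scalev (lo T)).
Local Notation wf := (wf k d T).
Local Notation powv := (powv p T conv red).
Local Notation sumv := (sumv k d T add).
Let wf_add := wf_add T_ok addE.
Let wf_mul := wf_mul p_gt0 T_ok k_gt0 d_gt0 size_nbs rows_okT convE redE.

Variables (S : comNzRingType) (beta : S).
Hypothesis pS : (p%:R = 0 :> S)%R.
Hypothesis beta_root : (beta ^+ d = ev beta nbs)%R.
Local Open Scope ring_scope.
Local Notation evv := (eval_vec T beta).
Local Notation evs := (eval_sym T beta).
Let evv_add := evv_add T_ok addE beta pS.
Let evv_mul :=
  evv_mul p_gt0 T_ok k_gt0 d_gt0 size_nbs rows_okT convE redE pS beta_root.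

Lemma powv_val v : wf v -> wf (powv v) /\ evv (powv v) = evv v ^+ p.
Proof.
move=> wf_v; rewrite /powv -[X in _ ^+ X](prednK p_gt0).
elim: p.-1 => [|n [wf_n IHn]]; first by rewrite expr1.
by rewrite iterS; split; [apply: wf_mul | rewrite exprS -IHn; apply: evv_mul].
Qed.

Lemma iter_powv_val i v : wf v ->
  wf (iter i powv v) /\ evv (iter i powv v) = evv v ^+ (p ^ i).
Proof.
move=> wf_v; elim: i => [|i [wf_i IHi]]; first by rewrite expr1.
have [wf_Si] := powv_val wf_i; rewrite IHi => evv_Si.
by rewrite iterS evv_Si -exprM expnSr.
Qed.

Lemma nth_conjs i v : (i < d)%N -> nth [::] (traject powv v d) i = iter i powv v.
Proof. by move=> lt_i; rewrite (set_nth_default v) ?size_traject // nth_traject. Qed.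

Lemma sumv_val vs : all wf vs -> wf (sumv vs) /\ evv (sumv vs) = \sum_(v <- vs) evv v.
Proof.
elim: vs => [|v vs IHvs] /=.
  split; first exact: (wf_zeros d p_gt0 T_ok k_gt0).
  by rewrite big_nil (evv_nseq0 p_gt0 T_ok).
case/andP=> wf_v /IHvs[wf_s evv_s]; rewrite big_cons -evv_s.
by split; [apply: wf_add | apply: evv_add].
Qed.

Hypothesis gam_wf : wf gam.
Let cg := traject powv gam d.
Let gamma := evv gam.

(** This is S_j(gamma^(p^t)), with the exponents reduced modulo d as in
[gtable]. *)
Definition gsum j t : S := \sum_(l < j) gamma ^+ (p ^ ((t + l) %% d)).
Definition lengths : seq nat := rev (iota 1 d.-1).
Definition values (w : seq nat) (n : nat) : seq S :=
  [seq \sum_(t < n) (nth 0%N w t)%:R * gsum j t | j <- lengths].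

Lemma cg_val i : wf (nth [::] cg (i %% d)) /\
  evv (nth [::] cg (i %% d)) = gamma ^+ (p ^ (i %% d)).
Proof. by rewrite /cg nth_conjs ?ltn_mod //; apply: iter_powv_val. Qed.

Let base t :=
  [seq sumv [seq nth [::] cg ((t + l) %% d) | l <- iota 0 j] | j <- lengths].

Lemma base_val t : all wf (base t) /\ map evv (base t) = [seq gsum j t | j <- lengths].
Proof.
have base_j j : wf (sumv [seq nth [::] cg ((t + l) %% d) | l <- iota 0 j]) /\
    evv (sumv [seq nth [::] cg ((t + l) %% d) | l <- iota 0 j]) = gsum j t.
  have [|wf_s ->] := @sumv_val [seq nth [::] cg ((t + l) %% d) | l <- iota 0 j].
    by rewrite all_map; apply/allP => l _; case: (cg_val (t + l)).
  split=> //; rewrite big_map /gsum -{1}[j]subn0 -/(index_iota 0 j) big_mkord.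
  by apply: eq_bigr => l _; case: (cg_val (t + l)).
split; first by rewrite all_map; apply/allP => j _; case: (base_j j).
by rewrite /base -map_comp; apply: eq_map => j /=; case: (base_j j).
Qed.

Lemma gtable_nth t a : (a < p)%N ->
  let e := nth (s0, [::]) (gtable p k d T add cg t) a in
  [/\ e.1 = sy a, all wf e.2 & map evv e.2 = [seq a%:R * gsum j t | j <- lengths]].
Proof.
move=> lt_a; rewrite /= (nth_map 0%N) ?size_iota // nth_iota // add0n /=.
have [wf_b evv_b] := base_val t; split=> //.
  by rewrite all_map; apply: sub_all wf_b => v wf_v; apply: (wf_scale T_ok).
transitivity [seq a%:R * y | y <- map evv (base t)]; last by rewrite evv_b -map_comp.
rewrite -!map_comp; apply: eq_map => v /=.
by rewrite (evv_scalev T_ok).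
Qed.

Lemma addvs_val us vs : all wf us -> all wf vs -> size us = size vs ->
  all wf (addvs addf us vs) /\
  map evv (addvs addf us vs) = [seq x.1 + x.2 | x <- zip (map evv us) (map evv vs)].
Proof.
elim: us vs => [|u us IHus] [|v vs] //= /andP[wf_u wf_us] /andP[wf_v wf_vs] [].
move=> /(IHus _ wf_us wf_vs)[-> ->]; rewrite andbT.
by split; [apply: wf_add | congr (_ :: _); apply: evv_add].
Qed.

Lemma values_step w n zs gs : all wf zs -> map evv zs = values w n ->
  all wf gs -> map evv gs = [seq (nth 0%N w n)%:R * gsum j n | j <- lengths] ->
  all wf (addvs addf zs gs) /\ map evv (addvs addf zs gs) = values w n.+1.
Proof.
move=> wf_zs evv_zs wf_gs evv_gs.
have size_zs : size zs = size lengths by rewrite -(size_map evv) evv_zs size_map.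
have size_gs : size gs = size lengths by rewrite -(size_map evv) evv_gs size_map.
have [|-> ->] := addvs_val wf_zs wf_gs; first by rewrite size_zs.
split=> //; rewrite evv_zs evv_gs /values; elim: lengths => //= j js ->.
by rewrite big_ord_recr.
Qed.

Definition horner_chain (c : S) (ys : seq S) : S :=
  foldr (fun y acc => 1 + c * y * acc) 1 ys.

Lemma nth_addv u v b : size u = size v -> (b < size u)%N ->
  nth s0 (addv (ad T) u v) b = ad T (nth s0 u b) (nth s0 v b).
Proof.
elim: u v b => [|a u IHu] [|c v] [|b] //= [size_uv] lt_b.
exact: IHu.
Qed.

(** Evaluating the columns one symbol at a time is the same as evaluating on
words, because multiplication by a constant acts on each symbol separately. *)
Lemma horner_columns c ms : all wf ms ->
  [seq horner_sym (ad T) (lo T) c [seq nth s0 m b | m <- ms] | b <- iota 0 nb] =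
  foldr (fun m acc => addv (ad T) m (scale c acc)) (nseq nb s0) ms.
Proof.
elim: ms => [_|m ms IHms /= /andP[wf_m wf_ms]] /=.
  by elim: nb 0%N => //= n IHn i; rewrite IHn.
have size_m : size m = nb := wf_size wf_m.
have size_tl :
    size (foldr (fun m acc => addv (ad T) m (scale c acc)) (nseq nb s0) ms) = nb.
  by rewrite -IHms // size_map size_iota.
apply: (@eq_from_nth _ s0) => [|b].
  by rewrite size_addv size_map size_iota size_m size_map size_tl maxnn.
rewrite size_map size_iota => lt_b.
rewrite (nth_map 0%N) ?size_iota // nth_iota // nth_addv ?size_m ?size_map //.
rewrite (nth_map s0) ?size_tl // -IHms //.
by rewrite (nth_map 0%N) ?size_iota // nth_iota.
Qed.

Lemma horner_columns_val c ms : (c < p)%N -> all wf ms ->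
  let v := foldr (fun m acc => addv (ad T) m (scale (sy c) acc)) (nseq nb s0) ms in
  wf v /\ evv v = foldr (fun y acc => y + c%:R * acc) 0 (map evv ms).
Proof.
move=> lt_c; elim: ms => [_|m ms IHms /= /andP[wf_m /IHms[wf_v evv_v]]] /=.
  by split; [apply: (wf_zeros d p_gt0 T_ok k_gt0) | rewrite (evv_nseq0 p_gt0 T_ok)].
have wf_cv := wf_scale T_ok lt_c wf_v.
rewrite -(addfE addE) //; split; first exact: wf_add.
by rewrite evv_add // (evv_scalev T_ok) // evv_v.
Qed.

Lemma prods_val m zs : wf m -> all wf zs ->
  [/\ all wf (prods mulf m zs), size (prods mulf m zs) = (size zs).+1 &
   forall c, foldr (fun y acc => y + c * acc) 0 (map evv (prods mulf m zs)) =
     evv m * horner_chain c (map evv zs)].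
Proof.
elim: zs m => [|z zs IHzs] m wf_m /=.
  by rewrite wf_m; split=> // c; rewrite mulr0 addr0 mulr1.
case/andP=> wf_z wf_zs; have [wf_p size_p evv_p] := IHzs _ (wf_mul wf_m wf_z) wf_zs.
rewrite wf_m wf_p size_p; split=> // c.
by rewrite evv_p evv_mul //; ring.
Qed.

Variable one : seq sym.
Hypotheses (one_wf : wf one) (one_val : evv one = 1).

Lemma leaf_sound zs : all wf zs -> (size zs).+1 = d ->
  leaf (nz T) mulf (horner (ad T) (lo T)) one [seq sy c | c <- iota 1 p.-1] zs ->
  forall c, (0 < c < p)%N -> exists v,
    [/\ wf v, has (nz T) v & evv v = horner_chain c%:R (map evv zs)].
Proof.
case: zs => [_ //|z zs] /= /andP[wf_z wf_zs] size_zs leaf_ok c /andP[c_gt0 lt_c].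
have [wf_p size_p evv_p] := prods_val wf_z wf_zs.
set ms := one :: prods mulf z zs in leaf_ok.
have wf_ms : all wf ms by rewrite /= one_wf.
have [wf_v evv_v] := horner_columns_val lt_c wf_ms.
eexists; split; [exact: wf_v| |].
  have lt_c1 : (c.-1 < size [seq sy c | c <- iota 1 p.-1])%N.
    by rewrite size_map size_iota -ltnS !prednK.
  have := allb_nth s0 leaf_ok lt_c1.
  rewrite size_map size_iota in lt_c1.
  rewrite (nth_map 0%N) ?size_iota // nth_iota // add1n prednK //.
  case/(hasb_nth [::])=> b; rewrite size_map size_iota (wf_size one_wf) => lt_b.
  rewrite (nth_map 0%N) ?size_iota ?(wf_size one_wf) //.
  rewrite nth_iota ?(wf_size one_wf) // add0n.
  have size_col : size [seq nth s0 m b | m <- ms] = d by rewrite size_map /= size_p.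
  rewrite hornerE /horner_spec unrollE // -horner_columns // => nz_b.
  apply/(has_nthP s0); exists b; first by rewrite size_map size_iota.
  by rewrite (nth_map 0%N) ?size_iota // nth_iota.
by rewrite evv_v /= one_val evv_p; ring.
Qed.

Arguments step : simpl never.
Arguments cyc : simpl never.

Section Traversal.
Variable w : seq nat.
Hypotheses (size_w : size w = d) (w_lt : all (fun a => (a < p)%N) w).
Hypothesis w_canonical : canonical p d w.
Hypothesis w_sum : (sumn w %% p)%N = 0%N.
Local Notation W := (letter d w).
Let leaf := leaf (nz T) mulf (horner (ad T) (lo T)) one [seq sy c | c <- iota 1 p.-1].
Let step_sound := step_sound p_gt1 T_ok d_gt1 size_w w_lt w_canonical.

Let W_nth t : (t < d)%N -> W t = nth 0%N w t.
Proof. by move=> lt_t; rewrite /letter modn_small. Qed.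

Lemma take_rcons t : (t < d)%N ->
  rcons (map sy (take t w)) (sy (W t)) = map sy (take t.+1 w).
Proof. by move=> lt_t; rewrite (take_nth 0%N) ?size_w // map_rcons W_nth. Qed.

Lemma prefix_take t : (t <= d)%N -> prefix_upto d w t (map sy (take t w)).
Proof.
move=> le_t i; have size_t : size (take t w) = t by rewrite size_takel ?size_w.
have [lt_i|le_i] := ltnP i d; last first.
  by rewrite nth_default // size_map size_t (leq_trans le_t).
case: ltnP => // lt_it; rewrite (nth_map 0%N) ?size_t // nth_take //.
by rewrite W_nth.
Qed.

Lemma sum_take t : (t < d)%N ->
  ad T (sy (sumn (take t w) %% p)) (sy (W t)) = sy (sumn (take t.+1 w) %% p).
Proof.
move=> lt_t; rewrite (ad_sy T_ok) ?ltn_mod ?(W_lt d_gt1 size_w w_lt) //.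
by rewrite modnDml (take_nth 0%N) ?size_w // sumn_rcons W_nth.
Qed.

Definition leaf_reached : Prop := exists zs,
  [/\ all wf zs, map evv zs = values w d & leaf zs].

Lemma search_sound gss t ps zs :
  (0 < t)%N -> (t + size gss)%N = d.-1 ->
  gss = [seq gtable p k d T add cg t' | t' <- iota t (size gss)] ->
  all_valid p d w t ps -> all wf zs -> map evv zs = values w t ->
  search (ad T) (lo T) (inv T) (nz T) addf mulf (horner (ad T) (lo T)) one
    [seq sy c | c <- iota 1 p.-1] gss (gtable p k d T add cg d.-1)
    (map sy (take t w)) ps (sy (sumn (take t w) %% p)) zs ->
  leaf_reached.
Proof.
elim: gss t ps zs => [|g gss IHgss] t ps zs t_gt0 /=.
  rewrite addn0 => def_t _ val_ps wf_zs evv_zs /(allb_nth (s0, [::])).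
  have lt_t : (t < d)%N by rewrite def_t prednK.
  have lt_W : (W t < p)%N := W_lt d_gt1 size_w w_lt t.
  move=> /(_ (W t)); rewrite size_map size_iota => /(_ lt_W).
  have [-> wf_g evv_g] := gtable_nth d.-1 lt_W.
  rewrite sum_take // (nz_sy T_ok) ?ltn_mod //.
  have -> : t.+1 = d by rewrite def_t prednK.
  rewrite take_oversize ?size_w // w_sum /= take_rcons // => step_ok.
  have [] := step_sound (prefix_take (ltnW lt_t)) _ _ step_ok; [|by []|].
    by split=> // _.
  have -> : t.+1 = d by rewrite def_t prednK.
  rewrite take_oversize ?size_w // => ps' val_ps'.
  have [|wf_l evv_l] := values_step wf_zs evv_zs wf_g.
    by rewrite evv_g -def_t W_nth.
  have St : t.+1 = d by rewrite def_t prednK.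
  rewrite St in evv_l => cyc_ok.
  exists (addvs addf zs (nth (s0, [::]) (gtable p k d T add cg d.-1) (W t)).2).
  split=> //; have w_upto := prefix_take (leqnn d).
  rewrite take_oversize ?size_w // in w_upto.
  apply: (cyc_sound p_gt1 T_ok d_gt1 size_w w_lt w_canonical w_upto (leqnn d) _
    val_ps' cyc_ok).
  apply: (@eq_from_nth _ s0) => [|n].
    by rewrite !size_map size_iota.
  rewrite size_map size_w => lt_n.
  rewrite !(nth_map 0%N) ?size_map ?size_w ?size_iota //.
  by rewrite nth_iota // add0n /letter modnDl modn_small.
move=> def_t [-> gss_eq] val_ps wf_zs evv_zs /(allb_nth (s0, [::])).
have lt_t : (t < d)%N by rewrite -(prednK d_gt0) -def_t; lia.
have lt_W : (W t < p)%N := W_lt d_gt1 size_w w_lt t.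
move=> /(_ (W t)); rewrite size_map size_iota => /(_ lt_W).
have [-> wf_g evv_g] := gtable_nth t lt_W.
rewrite take_rcons // sum_take // => step_ok.
have [] := step_sound (prefix_take (ltnW lt_t)) _ _ step_ok; [|by []|].
  by split=> // _.
move=> ps' val_ps'; have [|wf_l evv_l] := values_step wf_zs evv_zs wf_g.
  by rewrite evv_g W_nth.
by apply: IHgss => //; lia.
Qed.

Lemma first_letter t0 : (t0 < d)%N -> (forall t, (t < t0)%N -> W t = 0%N) ->
  W t0 <> 0%N -> W t0 = 1%N.
Proof.
move=> lt_t0 W_0 W_t0.
have Wt_p : (0 < W t0 < p)%N.
  by rewrite lt0n (W_lt d_gt1 size_w) // andbT; apply/eqP.
have [inv_p inv_W] := inv_sy p_gt0 T_ok Wt_p.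
have := @w_canonical _ 0%N t0 inv_p lt_t0; rewrite !add0n inv_W => W_le1.
apply/eqP; rewrite eqn_leq W_le1 ?lt0n; first by apply/eqP.
by move=> n /W_0; rewrite !add0n => ->; rewrite muln0 mod0n.
Qed.

(** Descends along the leading zeros of w to its first nonzero letter, which is
1 as w is canonical. *)
Lemma start_sound : has (fun a => a != 0%N) w ->
  start (ad T) (lo T) (inv T) (nz T) addf mulf (horner (ad T) (lo T)) one
    [seq sy c | c <- iota 1 p.-1]
    [seq gtable p k d T add cg t | t <- iota 0 d.-1]
    (gtable p k d T add cg d.-1) [::] ->
  leaf_reached.
Proof.
move=> w_n0; pose t0 := find (fun a => a != 0%N) w.
have lt_t0 : (t0 < d)%N by rewrite -size_w -has_find.
have W_0 t : (t < t0)%N -> nth 0%N w t = 0%N.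
  by move=> lt_t; have /negbFE/eqP := before_find 0%N lt_t.
have W_t0 : W t0 = 1%N.
  apply: first_letter => // [t lt_t|].
    by rewrite W_nth ?(ltn_trans lt_t) // W_0.
  by rewrite W_nth //; have /eqP := nth_find 0%N w_n0.
have take_0 t : (t <= t0)%N -> take t w = nseq t 0%N.
  move=> le_t; apply: (@eq_from_nth _ 0%N) => [|i].
    by rewrite size_takel ?size_nseq // size_w (leq_trans le_t) // ltnW.
  rewrite size_takel ?size_w ?(leq_trans le_t) ?(ltnW lt_t0) // => lt_i.
  by rewrite nth_take // nth_nseq lt_i W_0 // (leq_trans lt_i).
have sumn_nseq0 n : sumn (nseq n 0%N) = 0%N by rewrite sumn_nseq mul0n.
(* A single nonzero letter, at the end, would make the sum equal to 1. *)
have lt_t01 : (t0 < d.-1)%N.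
  rewrite -ltnS prednK // ltn_neqAle lt_t0 andbT; apply/eqP => eq_t0.
  have := w_sum; rewrite -{1}[w](take_oversize (n := d)) ?size_w //.
  rewrite -eq_t0 (take_nth 0%N) ?size_w // sumn_rcons take_0 // sumn_nseq0.
  by rewrite -W_nth // W_t0 modn_small.
have main t : (t <= t0)%N ->
    start (ad T) (lo T) (inv T) (nz T) addf mulf (horner (ad T) (lo T)) one
      [seq sy c | c <- iota 1 p.-1]
      [seq gtable p k d T add cg t' | t' <- iota t (d.-1 - t)]
      (gtable p k d T add cg d.-1) (nseq t s0) -> leaf_reached.
  move=> le_t; rewrite -(subKn le_t); move: (t0 - t)%N (leq_subr t t0) => m.
  elim: m => [|m IHm] le_m.
    rewrite subn0; have -> : (d.-1 - t0)%N = (d.-1 - t0).-1.+1 by lia.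
    rewrite /=; case: ifP => // search_ok _; move: search_ok.
    have [_ wf_g evv_g] := gtable_nth t0 p_gt1.
    have -> : rcons (nseq t0 s0) s1 = map sy (take t0.+1 w).
      by rewrite -take_rcons // W_t0 take_0 // map_nseq.
    have -> : s1 = sy (sumn (take t0.+1 w) %% p).
      rewrite (take_nth 0%N) ?size_w // sumn_rcons take_0 //.
      by rewrite sumn_nseq0 -W_nth // W_t0 modn_small.
    move=> search_ok; apply: (search_sound _ _ _ _ _ _ search_ok) => //.
    - by rewrite size_map size_iota; lia.
    - by rewrite size_map size_iota.
    rewrite evv_g /values; apply: eq_map => j; rewrite big_ord_recr /=.
    rewrite -W_nth // W_t0 big1 ?add0r // => t1 _.
    by rewrite W_0 // mul0r.
  have -> : (d.-1 - (t0 - m.+1))%N = (d.-1 - (t0 - m)).+1 by lia.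
  rewrite /=; case: ifP => // _.
  have -> : (t0 - m.+1).+1 = (t0 - m)%N by lia.
  have -> : rcons (nseq (t0 - m.+1) s0) s0 = nseq (t0 - m) s0.
    by rewrite -cats1 -[[:: s0]]/(nseq 1 s0) -nseqD; congr nseq; lia.
  by apply: IHm; lia.
by move=> start_ok; apply: (main 0%N) => //; rewrite subn0.
Qed.

End Traversal.
End SearchValues.

(** * From certificates to primes *)

Lemma trajectE (A : Type) (f : A -> A) x n :
  traject f x n = [seq iter i f x | i <- seq.iota 0 n].
Proof.
elim: n => // n IHn; rewrite trajectSr IHn -[in RHS]addn1 iotaD map_cat /=.
by rewrite add0n cats1.
Qed.

Section DigitPolynomials.
Local Open Scope ring_scope.

Lemma rmorph_ev (S S' : comNzRingType) (f : {rmorphism S -> S'}) x l :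
  f (ev x l) = ev (f x) l.
Proof.
by elim: l => [|a l IHl]; rewrite ?rmorph0 //= rmorphD rmorphM rmorph_nat IHl.
Qed.

Lemma horner_ev (R S : comNzRingType) (f : {rmorphism R -> S}) x l :
  (map_poly f (ev 'X l)).[x] = ev x l.
Proof.
elim: l => [|a l IHl]; first by rewrite rmorph0 horner0.
rewrite /= rmorphD rmorphM rmorph_nat /= map_polyX.
by rewrite hornerD hornerMn hornerC hornerM hornerX IHl.
Qed.

Lemma size_evX (R : comNzRingType) l : (size (ev ('X : {poly R}) l) <= size l)%N.
Proof.
elim: l => [|a l IHl] /=; first by rewrite size_poly0.
by rewrite addrC [_ * _]mulrC -polyC_natr size_MXaddC; case: ifP.
Qed.
End DigitPolynomials.

Lemma search_okE p k d T conv red add horner gam :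
  search_ok p k d T conv red add horner gam =
  let cg := traject (powv p T conv red) gam d in
  let gs := [seq gtable p k d T add cg t | t <- seq.iota 0 d] in
  start (ad T) (lo T) (inv T) (nz T) (add (ad T))
    (fun u v => red (ad T) (conv (ad T) (lo T) (hi T) u v)) (horner (ad T) (lo T))
    (xpow p k d 0) [seq sy c | c <- seq.iota 1 p.-1] (take d.-1 gs) (last [::] gs) [::].
Proof. by case: T. Qed.

Section NoWieferich.
Variables (p k d : nat) (T : tables) (nbs : seq nat).
Variable rows : seq (seq (seq sym)).
Variables (conv : op -> op -> op -> seq sym -> seq sym -> seq sym).
Variables (red : op -> seq sym -> seq sym).
Variables (add : op -> seq sym -> seq sym -> seq sym).
Variables (horner : op -> op -> sym -> seq sym -> sym).
Variables (disc_inv gam : seq sym) (basis : seq (seq nat)).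
Hypotheses (p_pr : prime p) (T_ok : tables_ok p k T).
Hypothesis convE : forall ad lo hi u v,
  conv ad lo hi u v = conv_spec k d ad lo hi u v.
Hypothesis redE : forall ad v, red ad v = red_spec k d rows ad v.
Hypothesis addE : forall ad u v, add ad u v = add_spec k d ad u v.
Hypothesis hornerE : forall ad lo c col,
  horner ad lo c col = horner_spec d ad lo c col.
Hypothesis certT : cert_ok p k d T nbs rows conv red add disc_inv gam basis.
Hypothesis searchT : search_ok p k d T conv red add horner gam.

Let p_gt1 : 1 < p := prime_gt1 p_pr.
Let p_gt0 : 0 < p := ltnW p_gt1.
Let mulf u v := red (ad T) (conv (ad T) (lo T) (hi T) u v).
Local Notation addf := (add (ad T)).
Local Notation scale := (scalev (lo T)).
Local Notation wf := (wf k d T).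
Local Notation powv := (powv p T conv red).
Local Notation sumv := (sumv k d T add).
Local Notation xpow := (xpow p k d).
Let cg := traject powv gam d.

Let k_gt0 : 0 < k. Proof. by case/andP: certT. Qed.
Let d_gt1 : 1 < d. Proof. by case/and3P: certT. Qed.
Let d_gt0 : 0 < d := ltnW d_gt1.
Let size_nbs : size nbs = d. Proof. by case/and4P: certT => _ _ /eqP. Qed.
Let rows_okT : rows_ok p k d T nbs rows.
Proof. by case/and5P: certT. Qed.
Let xpow_ok j : j < d -> enc_ok k d T (nseq j 0 ++ [:: 1]) (xpow j).
Proof.
move=> lt_j; case/and5P: certT => _ _ _ _ /andP[/allP/(_ j)].
by rewrite mem_iota lt_j => /(_ isT).
Qed.
Let disc_wf : wf disc_inv.
Proof. by case/and5P: certT => _ _ _ _ /and3P[]. Qed.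
Let gam_wf : wf gam.
Proof. by case/and5P: certT => _ _ _ _ /and4P[]. Qed.
Let xpow_fix : iter d powv (xpow 1) = xpow 1.
Proof.
case/and5P: certT => _ _ _ _ /and5P[_ _ _ /eqvP eq_x _].
rewrite -[RHS]eq_x -[X in traject _ _ X](prednK d_gt0) trajectS last_cons last_traject.
by rewrite -iterS prednK.
Qed.
Let disc_ok : foldr (fun y acc => mulf (addf y (scale (sy p.-1) (xpow 1))) acc)
  disc_inv (behead (traject powv (xpow 1) d)) = xpow 0.
Proof. by case/and5P: certT => _ _ _ _ /and5P[_ _ _ _ /andP[/eqvP]]. Qed.
Let trace_ok : sumv cg = xpow 0.
Proof. by case/and5P: certT => _ _ _ _ /and5P[_ _ _ _ /and3P[_ /eqvP]]. Qed.
Let basis_ok j : j < d -> let r := nth [::] basis j in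
  [/\ size r = d, all (fun c => c < p) r & lincomb k d T add r cg = xpow j].
Proof.
move=> lt_j; case/and5P: certT => _ _ _ _ /and5P[_ _ _ _ /and3P[_ _ /allP/(_ j)]].
by rewrite mem_iota lt_j => /(_ isT)/and3P[/eqP ? ? /eqvP].
Qed.

Local Open Scope ring_scope.

(** The computations with words are interpreted in an arbitrary ring with a root
beta of x^d - nu, since they are used twice: in the quotient of F_p[X] by this
polynomial, where they show that it divides 'X^(p^d) - 'X, and then in a field
with p^d elements. *)
Section InRing.
Variables (S : comNzRingType) (beta : S).
Hypothesis pS : p%:R = 0 :> S.
Hypothesis beta_root : beta ^+ d = ev beta nbs.
Local Notation evv := (eval_vec T beta).

Let wf_add := wf_add T_ok addE.
Let wf_mul := wf_mul p_gt0 T_ok k_gt0 d_gt0 size_nbs rows_okT convE redE.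
Let evv_add := evv_add T_ok addE beta pS.
Let evv_mul :=
  evv_mul p_gt0 T_ok k_gt0 d_gt0 size_nbs rows_okT convE redE pS beta_root.
Let iter_powv_val := iter_powv_val p_gt1 T_ok k_gt0 d_gt1 size_nbs rows_okT
  convE redE pS beta_root.

Lemma xpow_val j : (j < d)%N -> wf (xpow j) /\ evv (xpow j) = beta ^+ j.
Proof.
move=> lt_j; split; first by case/andP: (xpow_ok lt_j).
rewrite (evv_enc beta (xpow_ok lt_j)) ev_cat ev_nseq0 size_nseq add0r /=.
by rewrite mulr0 addr0 mulr1.
Qed.

Lemma root_fixed : beta ^+ (p ^ d) = beta.
Proof.
have [wf_x evv_x] := xpow_val d_gt1; have [_] := iter_powv_val d wf_x.
by rewrite xpow_fix evv_x expr1.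
Qed.

Lemma disc_unit : (evv disc_inv) * \prod_(1 <= i < d) (beta ^+ (p ^ i) - beta) = 1.
Proof.
have [wf_x evv_x] := xpow_val d_gt1; have [_ evv_1] := xpow_val d_gt0.
rewrite -[RHS](expr0 beta) -evv_1 -disc_ok.
have -> : behead (traject powv (xpow 1) d) =
    [seq iter i powv (xpow 1) | i <- seq.iota 1 d.-1].
  by rewrite trajectE -[X in seq.iota 0 X](prednK d_gt0).
rewrite /index_iota subn1.
(* The certificate subtracts x by adding p - 1 times x. *)
have p1_lt : (p.-1 < p)%N by rewrite prednK.
have wf_nx := wf_scale T_ok p1_lt wf_x.
have evv_nx : evv (scale (sy p.-1) (xpow 1)) = - beta.
  rewrite (evv_scalev T_ok) // evv_x expr1 -[in RHS](mul1r beta) -mulNr; congr (_ * _).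
  by apply/eqP; rewrite -subr_eq0 opprK natr1 prednK // pS.
elim: (seq.iota 1 d.-1) => [|i js]; first by rewrite big_nil mulr1.
rewrite big_cons => IHjs.
have wf_fold js' : wf (foldr (fun y acc => mulf (addf y (scale (sy p.-1) (xpow 1))) acc)
    disc_inv [seq iter i powv (xpow 1) | i <- js']).
  elim: js' => //= i' js' wf_js.
  exact: (wf_mul (wf_add (iter_powv_val i' wf_x).1 wf_nx) wf_js).
have [wf_i evv_i] := iter_powv_val i wf_x; rewrite evv_x expr1 in evv_i.
have wf_head := wf_add wf_i wf_nx.
rewrite [foldr _ _ _]/= (evv_mul wf_head (wf_fold js)) -IHjs.
by rewrite (evv_add wf_i wf_nx) evv_nx evv_i mulrCA.
Qed.

Lemma trace_unit : \sum_(t < d) (evv gam) ^+ (p ^ t) = 1.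
Proof.
have [_ evv_1] := xpow_val d_gt0; rewrite expr0 -trace_ok in evv_1.
have [|_] := sumv_val p_gt1 T_ok k_gt0 addE beta pS (vs := cg).
  rewrite /cg trajectE all_map; apply/allP => i _.
  by case: (iter_powv_val i gam_wf).
rewrite evv_1 => ->; rewrite /cg trajectE big_map.
rewrite -(big_mkord xpredT (fun t => evv gam ^+ (p ^ t))) /index_iota subn0.
by apply: eq_bigr => i _; case: (iter_powv_val i gam_wf).
Qed.

Lemma basis_val j : (j < d)%N ->
  exists c : nat -> nat, beta ^+ j = \sum_(t < d) (c t)%:R * (evv gam) ^+ (p ^ t).
Proof.
move=> lt_j; have [_ <-] := xpow_val lt_j; have [] := basis_ok lt_j.
set r := nth [::] basis j => size_r r_lt <-; exists (nth 0%N r).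
pose terms := [seq (nth 0%N r t, iter t powv gam) | t <- seq.iota 0 d].
rewrite /lincomb; have -> : zip r cg = terms.
  rewrite /terms /cg trajectE -[in LHS](mkseq_nth 0%N r) size_r /mkseq.
  by elim: (seq.iota 0 d) => //= t ts ->.
have scale_val t : wf (scale (sy (nth 0%N r t)) (iter t powv gam)) /\
    evv (scale (sy (nth 0%N r t)) (iter t powv gam)) =
      (nth 0%N r t)%:R * evv gam ^+ (p ^ t).
  have lt_r : (nth 0%N r t < p)%N.
    have [lt_t|le_t] := ltnP t (size r); last by rewrite nth_default.
    exact: (all_nthP 0%N r_lt).
  have [wf_t <-] := iter_powv_val t gam_wf.
  by split; [apply: (wf_scale T_ok) | apply: (evv_scalev T_ok)].
have [|_ ->] := sumv_val p_gt1 T_ok k_gt0 addE beta pS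
  (vs := [seq scale (sy x.1) x.2 | x <- terms]).
  by rewrite -map_comp all_map; apply/allP => t _; case: (scale_val t).
rewrite -map_comp big_map.
rewrite -(big_mkord xpredT (fun t => (nth 0%N r t)%:R * evv gam ^+ (p ^ t)))
  /index_iota subn0.
by apply: eq_bigr => t _; case: (scale_val t).
Qed.
End InRing.

Definition modulus : {poly 'F_p} := 'X^d - ev 'X nbs.

Lemma size_modulus : size modulus = d.+1.
Proof.
rewrite size_polyDl size_polyXn // size_polyN ltnS.
by rewrite (leq_trans (size_evX _ _)) ?size_nbs.
Qed.

Lemma modulus_monic : modulus \is monic.
Proof.
rewrite monicE lead_coefDl ?lead_coefXn // size_polyXn size_polyN ltnS.
by rewrite (leq_trans (size_evX _ _)) ?size_nbs.
Qed.

(** In the quotient ring by the modulus, the class of 'X is a root beta as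
above, and the computation x^(p^d) = x is the asserted divisibility. *)
Lemma modulus_dvd : modulus %| 'X^(p ^ d) - 'X.
Proof.
pose pi := in_qpoly modulus.
have mkE : mk_monic modulus = modulus.
  by rewrite /mk_monic size_modulus modulus_monic ltnS d_gt0.
have pS : p%:R = 0 :> {poly %/ modulus}.
  by rewrite -(rmorph_nat pi) -polyC_natr (pcharf0 (pchar_Fp p_pr)) rmorph0.
have root_pi : pi 'X ^+ d = ev (pi 'X) nbs.
  apply/eqP; rewrite -subr_eq0 -(rmorph_ev pi) -rmorphXn -rmorphB -/modulus.
  by apply/eqP/val_inj; rewrite /= mkE Pdiv.RingMonic.rmodpp ?modulus_monic.
have /eqP := root_fixed pS root_pi.
rewrite -subr_eq0 -rmorphXn -rmorphB => /eqP/(congr1 val)/= /eqP.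
by rewrite mkE -[_ == 0]/(Pdiv.Ring.rdvdp _ _) Pdiv.Idomain.dvdpE.
Qed.

Section InField.
Variables (L : finFieldType) (iota : {rmorphism 'F_p -> L}).
Hypothesis cardL : #|L| = (p ^ d)%N.

Let pL : p%:R = 0 :> L.
Proof. by rewrite -(rmorph_nat iota) (pcharf0 (pchar_Fp p_pr)) rmorph0. Qed.

(** The polynomial 'X^(p^d) - 'X splits over L, hence so does its divisor. *)
Lemma modulus_root : exists beta : L, beta ^+ d = ev beta nbs.
Proof.
have: map_poly iota modulus %| \prod_(x <- enum L) ('X - x%:P).
  rewrite big_enum -finField_genPoly cardL.
  have -> : 'X^(p ^ d) - 'X = map_poly iota ('X^(p ^ d) - 'X).
    by rewrite rmorphB rmorphXn /= map_polyX.
  by rewrite dvdp_map modulus_dvd.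
case/dvdp_prod_XsubC => m eqp_m.
have size_m : size (mask m (enum L)) = d.
  have := eqp_size eqp_m; rewrite size_map_poly size_modulus size_prod_XsubC.
  by case.
case def_s: (mask m (enum L)) size_m => [|beta s] size_m.
  by move: d_gt1; rewrite -size_m.
exists beta; apply/eqP; rewrite -subr_eq0.
have: root (map_poly iota modulus) beta.
  by rewrite (eqp_root eqp_m) def_s root_prod_XsubC mem_head.
by rewrite rootE rmorphB rmorphXn /= map_polyX hornerD hornerN hornerXn horner_ev.
Qed.

(** An equality beta^(p^m) = beta with 0 < m < d would annihilate a product that
the certificate inverts. *)
Lemma root_conj_uniq (beta : L) : beta ^+ d = ev beta nbs -> uniq (conj_seq p d beta).
Proof.
move=> root_beta; apply: (conj_uniq iota p_pr) => m /andP[m_gt0 lt_m].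
have := disc_unit pL root_beta; apply: contra_eq_neq => fix_m.
rewrite (bigD1_seq m) ?iota_uniq ?mem_index_iota ?m_gt0 //=.
by rewrite fix_m subrr mul0r mulr0 eq_sym oner_neq0.
Qed.

Section NormalBasis.
Variable beta : L.
Hypothesis beta_root : beta ^+ d = ev beta nbs.
Local Notation evv := (eval_vec T beta).
Let gamma := evv gam.
Let uniq_beta : uniq (conj_seq p d beta) := root_conj_uniq beta_root.

Definition normal_sum (w : seq nat) : L :=
  \sum_(t < d) (nth 0%N w t)%:R * gamma ^+ (p ^ t).

(** The powers of beta span L because beta has d distinct conjugates, and the
certificate expresses them through the conjugates of gamma. *)
Lemma normal_span y : exists w,
  [/\ size w = d, all (fun a => (a < p)%N) w & y = normal_sum w].
Proof.
pose span y := exists c : nat -> 'F_p, y = \sum_(t < d) iota (c t) * gamma ^+ (p ^ t).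
have [c ->] : span y.
  have [g le_g ->] := horner_conj_onto iota p_pr cardL y uniq_beta.
  rewrite (horner_coef_wide _ (n := d)) ?size_map_poly //.
  elim/big_ind: _ => [|y1 y2 [c1 ->] [c2 ->]|j _].
  - exists (fun=> 0); rewrite big1 // => t _; by rewrite rmorph0 mul0r.
  - exists (fun t => c1 t + c2 t); rewrite -big_split; apply: eq_bigr => t _.
    by rewrite rmorphD mulrDl.
  have [c ->] := basis_val pL beta_root (ltn_ord j).
  exists (fun t => g`_j * (c t)%:R); rewrite big_distrr; apply: eq_bigr => t _.
  by rewrite coef_map rmorphM rmorph_nat -mulrA.
exists (mkseq (fun t => (c t : nat)) d); split.
- by rewrite size_mkseq.
- by apply/allP => _ /mapP[t _ ->]; rewrite -[X in (_ < X)%N](Fp_cast p_pr) ltn_ord.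
apply: eq_bigr => t _; rewrite nth_mkseq // -(rmorph_nat iota); congr (iota _ * _).
by rewrite natr_Zp.
Qed.

Lemma exp_modd (x : L) n : x ^+ (p ^ (n %% d)) = x ^+ (p ^ n).
Proof.
rewrite [in RHS](divn_eq n d) expnD exprM mulnC expnM.
have -> : x ^+ ((p ^ d) ^ (n %/ d)) = x; last by [].
by elim: (n %/ d)%N => [|m IHm]; rewrite ?expr1 // expnS exprM -cardL expf_card cardL.
Qed.

(** This is E(cz), as the partial traces are linear over F_p. *)
Definition trace_chain (c z : L) : L :=
  horner_chain c [seq \sum_(l < j) z ^+ (p ^ l) | j <- lengths d].

Lemma exp_p0 l : (0 : L) ^+ (p ^ l) = 0.
Proof. by rewrite expr0n expn_eq0 eqn0Ngt p_gt0. Qed.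

Lemma expf_p_sum l n (F : 'I_n -> L) :
  (\sum_(t < n) F t) ^+ (p ^ l) = \sum_(t < n) F t ^+ (p ^ l).
Proof.
exact: (big_morph (fun x : L => x ^+ (p ^ l)) (expf_pD iota p_pr l) (exp_p0 l)).
Qed.

Lemma expf_p_natr l n : (n%:R : L) ^+ (p ^ l) = n%:R.
Proof. by rewrite -(rmorph_nat iota) iota_expf_p. Qed.

Lemma trace_normal_sum j w :
  \sum_(l < j) normal_sum w ^+ (p ^ l) =
  \sum_(t < d) (nth 0%N w t)%:R * gsum p d T gam beta j t.
Proof.
under [RHS]eq_bigr do rewrite big_distrr /=.
rewrite [RHS]exchange_big; apply: eq_bigr => l _.
rewrite /normal_sum expf_p_sum; apply: eq_bigr => t _.
by rewrite exprMn exp_modd -exprM -expnD expf_p_natr.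
Qed.

Lemma values_trace w : values p d T gam beta w d =
  [seq \sum_(l < j) normal_sum w ^+ (p ^ l) | j <- lengths d].
Proof. by apply: eq_map => j; rewrite trace_normal_sum. Qed.

Lemma trace_sumn w : size w = d ->
  \sum_(l < d) normal_sum w ^+ (p ^ l) = (sumn w)%:R.
Proof.
move=> size_w; rewrite trace_normal_sum.
have gsum1 t : gsum p d T gam beta d t = 1.
  rewrite -(expr1n L (p ^ t)) -(trace_unit pL beta_root) expf_p_sum.
  by apply: eq_bigr => l _; rewrite exp_modd -exprM -expnD addnC.
rewrite sumnE natr_sum (big_nth 0%N) size_w big_mkord.
by apply: eq_bigr => t _; rewrite gsum1 mulr1.
Qed.

Lemma normal_sum_turn c j w :
  normal_sum (turn p d c j w) ^+ (p ^ j) = c%:R * normal_sum w.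
Proof.
rewrite /normal_sum expf_p_sum big_distrr /=.
pose h (t : 'I_d) := Ordinal (ltn_pmod (j + t) d_gt0).
(* Rotation permutes the exponents of the conjugates of gamma modulo d. *)
have h_inj : injective h.
  move=> t1 t2 /(congr1 val)/eqP; rewrite /= eqn_modDl !modn_small //.
  by move/eqP/val_inj.
rewrite [RHS](reindex_inj h_inj); apply: eq_bigr => t _.
rewrite nth_mkseq // (natr_mod pL) natrM exprMn -exprM -expnD -exp_modd.
rewrite [(t + j)%N]addnC exp_modd -(exp_modd _ (j + t)) exprMn !expf_p_natr.
by rewrite mulrA.
Qed.

Lemma coef_ev (l : seq nat) n : (ev ('X : {poly 'F_p}) l)`_n = (nth 0%N l n)%:R.
Proof.
elim: l n => [|a l IHl] n /=; first by rewrite coef0 nth_nil.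
rewrite coefD coefXM -polyC_natr coefC.
by case: n => [|n] /=; rewrite ?addr0 // add0r IHl.
Qed.

(** A reduced word with value zero is a polynomial of degree less than d that
vanishes at the d distinct conjugates of beta, so its digits are zero. *)
Lemma evv_neq0 v : wf v -> has (nz T) v -> evv v != 0.
Proof.
move=> wf_v has_v; apply/eqP => evv0.
have /wfP[_ zero_v] := wf_v.
pose g : {poly 'F_p} := ev 'X (take d (digv T v)).
have g0 : g = 0.
  apply: (horner_conj_eq0 (iota := iota) p_pr uniq_beta).
    by rewrite (leq_trans (size_evX _ _)) // size_take_min geq_minl.
  rewrite horner_ev -evv0 /eval_vec -[in RHS](cat_take_drop d (digv T v)) ev_cat.
  suff -> : ev beta (drop d (digv T v)) = 0 by rewrite mulr0 addr0.
  have -> : drop d (digv T v) = nseq (size (drop d (digv T v))) 0%N.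
    apply: (@eq_from_nth _ 0%N) => [|i _]; first by rewrite size_nseq.
    by rewrite nth_nseq if_same nth_drop zero_v ?leq_addr.
  exact: ev_nseq0.
have digits_lt : all (fun x => (x < p)%N) (digv T v).
  elim: (v) => //= a u IHu; rewrite all_cat IHu andbT; exact: (dg_lt T_ok).
have zero_digits n : nth 0%N (digv T v) n = 0%N.
  have [lt_n|le_n] := ltnP n d; last exact: zero_v.
  have := coef_ev (take d (digv T v)) n; rewrite -/g g0 coef0 nth_take //.
  move/esym/eqP; rewrite -(dvdn_pcharf (pchar_Fp p_pr)) => dvd_n.
  have [lt_s|le_s] := ltnP n (size (digv T v)); last by rewrite nth_default.
  have := all_nthP 0%N digits_lt n lt_s.
  by case: (nth _ _ n) dvd_n => // m /(dvdn_leq (ltn0Sn m)) le_p; rewrite ltnNge le_p.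
case/(has_nthP s0): has_v => i lt_i; rewrite (nzE T_ok) => /(has_nthP 0%N)[j lt_j].
rewrite (size_dg T_ok) in lt_j; have := zero_digits (k * i + j)%N.
suff -> : nth 0%N (digv T v) (k * i + j) = nth 0%N (dg T (nth s0 v i)) j.
  by move=> ->; rewrite eqxx.
elim: v i lt_i {wf_v evv0 zero_v g g0 digits_lt zero_digits} => //= a v IHv [|i] lt_i.
  by rewrite muln0 add0n nth_cat (size_dg T_ok) lt_j.
rewrite nth_cat (size_dg T_ok) mulnS -addnA ltnNge leq_addr /= addKn.
exact: IHv.
Qed.

Lemma canonical_chain_neq0 w c : size w = d -> all (fun a => (a < p)%N) w ->
  canonical p d w -> (sumn w %% p)%N = 0%N -> has (fun a => a != 0%N) w ->
  (0 < c < p)%N -> trace_chain c%:R (normal_sum w) != 0.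
Proof.
move=> size_w w_lt w_can w_sum w_n0 c_p.
have [one_wf one_val] := xpow_val beta d_gt0; rewrite expr0 in one_val.
have start_ok := searchT; rewrite search_okE /= -map_take in start_ok.
have take_iota : take d.-1 (seq.iota 0 d) = seq.iota 0 d.-1.
  by rewrite take_iota (minn_idPl (leq_pred d)).
rewrite take_iota in start_ok.
have last_iota : last [::] [seq gtable p k d T add cg t | t <- seq.iota 0 d] =
    gtable p k d T add cg d.-1.
  by rewrite -[X in seq.iota 0 X](prednK d_gt0) -addn1 iotaD map_cat last_cat.
rewrite last_iota in start_ok.
have [zs [wf_zs evv_zs leaf_zs]] := start_sound p_gt1 T_ok k_gt0 d_gt1 size_nbs
  rows_okT convE redE addE pL beta_root gam_wf one_wf size_w w_lt w_can w_sum w_n0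
  start_ok.
have size_zs : (size zs).+1 = d.
  by rewrite -(size_map evv) evv_zs size_map size_rev size_iota prednK.
have [v [wf_v nz_v evv_v]] := leaf_sound p_gt1 T_ok k_gt0 d_gt1 size_nbs
  rows_okT convE redE addE hornerE pL beta_root one_wf one_val wf_zs size_zs
  leaf_zs c_p.
by rewrite /trace_chain -values_trace -evv_zs -evv_v evv_neq0.
Qed.

Lemma trace_chain_expp c z m :
  trace_chain c%:R (z ^+ (p ^ m)) = trace_chain c%:R z ^+ (p ^ m).
Proof.
rewrite /trace_chain; elim: (lengths d) => [|j js IHjs] /=; first by rewrite expr1n.
rewrite IHjs (expf_pD iota p_pr) expr1n !exprMn expf_p_natr; congr (1 + _ * _ * _).
by rewrite expf_p_sum; apply: eq_bigr => l _; rewrite -!exprM mulnC.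
Qed.

Lemma trace_chain_scale c z : trace_chain 1 (c%:R * z) = trace_chain c%:R z.
Proof.
rewrite /trace_chain; elim: (lengths d) => //= j js ->; congr (1 + _ * _).
rewrite mul1r big_distrr; apply: eq_bigr => l _.
by rewrite exprMn expf_p_natr.
Qed.

Lemma natr_eq0L n : (n%:R == 0 :> L) = (n %% p == 0)%N.
Proof.
have pcharL : p \in [pchar L] by rewrite (fmorph_pchar iota) pchar_Fp.
by rewrite -(dvdn_pcharf pcharL).
Qed.

(** Up to a constant factor c1 and a power of Frobenius, z is given by a
canonical word w0. The factor is absorbed by the scalar in [trace_chain], and
Frobenius commutes with E; the trace of w0 is zero like that of z. *)
Lemma trace_chain_neq0 z : \sum_(l < d) z ^+ (p ^ l) = 0 -> trace_chain 1 z != 0.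
Proof.
move=> trace0; have [->|z_n0] := eqVneq z 0.
  rewrite /trace_chain; elim: (lengths d) => [|j js _] /=; first exact: oner_neq0.
  by rewrite big1 ?mulr0 ?mul0r ?addr0 ?oner_neq0 // => l _; apply: exp_p0.
have [w [size_w w_lt def_z]] := normal_span z.
have [c [j [c_p lt_j w_can]]] := exists_canonical p_gt0 d_gt0 w p_pr.
have w0_z := normal_sum_turn c j w; set w0 := turn p d c j w in w_can w0_z.
have c_lt : (c < p)%N by case/andP: c_p.
have [c1_p c1_c] := inv_sy p_gt0 T_ok c_p.
set c1 := idx _ in c1_p c1_c.
have z_w0 : z = c1%:R * normal_sum w0 ^+ (p ^ j).
  by rewrite w0_z -def_z mulrA -natrM -(natr_mod pL) c1_c mul1r.
have size_w0 : size w0 = d by rewrite size_mkseq.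
rewrite z_w0 trace_chain_scale trace_chain_expp expf_neq0 //.
apply: canonical_chain_neq0 => //.
- by apply/allP => _ /mapP[t _ ->]; rewrite ltn_mod.
- apply/eqP; rewrite -natr_eq0L -(trace_sumn size_w0).
  suff: (\sum_(l < d) normal_sum w0 ^+ (p ^ l)) ^+ (p ^ j) == 0.
    by rewrite expf_eq0 => /andP[].
  rewrite expf_p_sum (eq_bigr (fun l : 'I_d => c%:R * z ^+ (p ^ l))).
    by rewrite -big_distrr /= trace0 mulr0.
  move=> l _; rewrite -exprM mulnC exprM w0_z -def_z exprMn.
  by rewrite expf_p_natr.
apply: contraR z_n0 => /hasPn w0_0; rewrite z_w0.
suff -> : normal_sum w0 = 0 by rewrite exp_p0 mulr0.
rewrite /normal_sum big1 // => t _.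
have [lt_t|le_t] := ltnP t (size w0); last by rewrite nth_default ?mul0r.
by have := w0_0 _ (mem_nth 0%N lt_t); rewrite negbK => /eqP ->; rewrite mul0r.
Qed.

Lemma trace_difference (theta : L) n :
  \sum_(l < n) (theta - theta ^+ p) ^+ (p ^ l) = theta - theta ^+ (p ^ n).
Proof.
elim: n => [|n IHn]; first by rewrite big_ord0 expr1 subrr.
rewrite big_ord_recr /= IHn (expf_pB iota p_pr) -exprM -expnS.
by rewrite addrA subrK.
Qed.

Lemma carlitz_horner_chain (theta : L) :
  carlitz_horner p theta d.-1 = trace_chain 1 (theta - theta ^+ p).
Proof.
rewrite /trace_chain /lengths; elim: d.-1 => [|n IHn] //.
rewrite -addn1 iotaD rev_cat map_cat /= -IHn add1n mul1r trace_difference.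
by rewrite addn1.
Qed.
End NormalBasis.
End InField.

(** The field L is F_p[X]/(P) and theta the class of 'X. The word arithmetic
uses another generator beta of L, which is independent of P. *)
Theorem no_c_wieferich : ~ exists P : {poly 'F_p}, size P = d.+1 /\ c_wieferich P.
Proof.
case=> P [size_P wP]; have [monP irrP _] := wP.
have mi : monic_irreducible_poly P by split.
pose L : finFieldType := {poly %/ P with mi}.
pose pi : {rmorphism {poly 'F_p} -> L} := in_qpoly P.
pose iota : {rmorphism 'F_p -> L} := (pi \o polyC)%FUN.
have cardL : #|L| = (p ^ d)%N by rewrite card_qfpoly size_P card_Fp.
pose theta : L := pi 'X.
have piE g : pi g = (map_poly iota g).[theta].
  elim/poly_ind: g => [|g c IHg]; first by rewrite !rmorph0 horner0.
  rewrite !rmorphD !rmorphM /= map_polyX map_polyC /= hornerD hornerM hornerX hornerC.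
  by rewrite -IHg.
have theta_gen y : exists g, y = (map_poly iota g).[theta].
  exists (val y); rewrite -piE; apply: val_inj; rewrite /=.
  by rewrite Pdiv.Ring.rmodp_small // size_mk_monic.
have root_theta : (map_poly iota P).[theta] = 0.
  rewrite -piE; apply: val_inj; rewrite /= mk_monicE //.
  by rewrite Pdiv.RingMonic.rmodpp.
have facP := gen_conj_factor p_pr cardL theta_gen monP size_P root_theta.
have horner_theta : carlitz_horner p theta d.-1 = 0.
  by apply: (wieferich_carlitz_horner (iota := iota) p_pr _ wP); rewrite prednK // facP.
have [beta root_beta] := modulus_root iota cardL.
(* The trace telescopes, and theta is fixed by the d-th power of Frobenius. *)
have trace0 : \sum_(l < d) (theta - theta ^+ p) ^+ (p ^ l) = 0.
  by rewrite (trace_difference iota) -cardL expf_card subrr.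
have /eqP := trace_chain_neq0 iota cardL root_beta trace0.
by rewrite -(carlitz_horner_chain iota); apply; apply: horner_theta.
Qed.
End NoWieferich.

(** * The thirty pairs *)

Definition no_wieferich (d p : nat) : Prop :=
  ~ exists P : {poly 'F_p}, size P = d.+1 /\ c_wieferich P.

(** The loop-free operations are obtained by evaluation and are convertible to
their specifications, so reflexivity proves the four equations. The data are the
coefficients of nu, the words disc_inv and gam as lists of codes, and the matrix
that expresses 1, x, ..., x^(d-1) through gamma, gamma^p, .... *)
Ltac by_certificate p_prime p k d T T_ok nbs disc_inv gam basis :=
  let rows := eval vm_compute in (make_rows p k d nbs) in
  let conv := eval cbv in (conv_spec k d) in
  let red := eval cbv in (red_spec k d rows) in
  let add := eval cbv in (add_spec k d) in
  let horner := eval cbv in (horner_spec d) in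
  let disc_inv := eval cbv in (map sy disc_inv) in
  let gam := eval cbv in (map sy gam) in
  let cert := constr:(ltac:(vm_cast_no_check (erefl true)) :
    cert_ok p k d T nbs rows conv red add disc_inv gam basis = true) in
  let search := constr:(ltac:(vm_cast_no_check (erefl true)) :
    search_ok p k d T conv red add horner gam = true) in
  exact (@no_c_wieferich p k d T nbs rows conv red add horner
    disc_inv gam basis p_prime T_ok
    (fun _ _ _ _ _ => erefl) (fun _ _ => erefl) (fun _ _ _ => erefl)
    (fun _ _ _ _ => erefl) cert search).

Definition tables3 := Eval vm_compute in make_tables 3 4.
Lemma tables3_ok : tables_ok 3 4 tables3.
Proof. by vm_cast_no_check (erefl true). Qed.

Definition tables5 := Eval vm_compute in make_tables 5 3.
Lemma tables5_ok : tables_ok 5 3 tables5.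
Proof. by vm_cast_no_check (erefl true). Qed.

Definition tables7 := Eval vm_compute in make_tables 7 2.
Lemma tables7_ok : tables_ok 7 2 tables7.
Proof. by vm_cast_no_check (erefl true). Qed.

Definition tables11 := Eval vm_compute in make_tables 11 1.
Lemma tables11_ok : tables_ok 11 1 tables11.
Proof. by vm_cast_no_check (erefl true). Qed.

Definition tables13 := Eval vm_compute in make_tables 13 1.
Lemma tables13_ok : tables_ok 13 1 tables13.
Proof. by vm_cast_no_check (erefl true). Qed.

Definition tables17 := Eval vm_compute in make_tables 17 1.
Lemma tables17_ok : tables_ok 17 1 tables17.
Proof. by vm_cast_no_check (erefl true). Qed.

Definition tables19 := Eval vm_compute in make_tables 19 1.
Lemma tables19_ok : tables_ok 19 1 tables19.
Proof. by vm_cast_no_check (erefl true). Qed.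

Definition tables23 := Eval vm_compute in make_tables 23 1.
Lemma tables23_ok : tables_ok 23 1 tables23.
Proof. by vm_cast_no_check (erefl true). Qed.

Definition tables29 := Eval vm_compute in make_tables 29 1.
Lemma tables29_ok : tables_ok 29 1 tables29.
Proof. by vm_cast_no_check (erefl true). Qed.

Definition tables31 := Eval vm_compute in make_tables 31 1.
Lemma tables31_ok : tables_ok 31 1 tables31.
Proof. by vm_cast_no_check (erefl true). Qed.

Definition tables37 := Eval vm_compute in make_tables 37 1.
Lemma tables37_ok : tables_ok 37 1 tables37.
Proof. by vm_cast_no_check (erefl true). Qed.

Lemma no_wieferich_5_3 : no_wieferich 5 3.
Proof.
by_certificate (isT : prime 3) 3 4 5 tables3 tables3_ok [:: 1; 1; 0; 0; 0] [::
  40; 1] [:: 0; 1] [:: [:: 1; 1; 1; 1; 1]; [:: 2; 2; 1; 1; 0]; [:: 2; 0; 2; 1;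
  1]; [:: 0; 2; 2; 1; 1]; [:: 1; 0; 0; 0; 0]].
Qed.

Lemma no_wieferich_5_7 : no_wieferich 5 7.
Proof.
by_certificate (isT : prime 7) 7 2 5 tables7 tables7_ok [:: 1; 3; 0; 0; 0] [::
  32; 31; 3] [:: 0; 0; 3] [:: [:: 1; 1; 1; 1; 1]; [:: 2; 1; 4; 2; 5]; [:: 4;
  1; 1; 3; 5]; [:: 5; 5; 0; 5; 6]; [:: 5; 0; 0; 0; 0]].
Qed.

Lemma no_wieferich_5_11 : no_wieferich 5 11.
Proof.
by_certificate (isT : prime 11) 11 1 5 tables11 tables11_ok [:: 1; 1; 0; 0; 0]
  [:: 4; 1; 8; 9; 6] [:: 0; 0; 0; 0; 3] [:: [:: 1; 1; 1; 1; 1]; [:: 0; 0; 2;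
  6; 3]; [:: 9; 1; 10; 5; 8]; [:: 7; 9; 0; 8; 9]; [:: 4; 0; 0; 0; 0]].
Qed.

Lemma no_wieferich_5_13 : no_wieferich 5 13.
Proof.
by_certificate (isT : prime 13) 13 1 5 tables13 tables13_ok [:: 1; 1; 0; 0; 0]
  [:: 1; 3; 8; 4; 2] [:: 0; 0; 0; 0; 10] [:: [:: 1; 1; 1; 1; 1]; [:: 3; 8; 10;
  2; 3]; [:: 8; 12; 1; 7; 11]; [:: 4; 7; 10; 7; 11]; [:: 4; 0; 0; 0; 0]].
Qed.

Lemma no_wieferich_5_17 : no_wieferich 5 17.
Proof.
by_certificate (isT : prime 17) 17 1 5 tables17 tables17_ok [:: 1; 10; 0; 0;
  0] [:: 9; 8; 4; 2; 1] [:: 0; 0; 0; 0; 3] [:: [:: 1; 1; 1; 1; 1]; [:: 4; 12;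
  9; 4; 5]; [:: 6; 5; 12; 13; 15]; [:: 3; 3; 4; 0; 7]; [:: 6; 0; 0; 0; 0]].
Qed.

Lemma no_wieferich_5_19 : no_wieferich 5 19.
Proof.
by_certificate (isT : prime 19) 19 1 5 tables19 tables19_ok [:: 1; 3; 0; 0; 0]
  [:: 1; 16; 11; 4; 17] [:: 0; 0; 0; 0; 8] [:: [:: 1; 1; 1; 1; 1]; [:: 17; 17;
  13; 2; 8]; [:: 3; 6; 14; 14; 1]; [:: 15; 0; 11; 15; 16]; [:: 12; 0; 0; 0;
  0]].
Qed.

Lemma no_wieferich_5_23 : no_wieferich 5 23.
Proof.
by_certificate (isT : prime 23) 23 1 5 tables23 tables23_ok [:: 1; 3; 0; 0; 0]
  [:: 9; 1; 16; 3; 2] [:: 0; 0; 0; 0; 2] [:: [:: 1; 1; 1; 1; 1]; [:: 2; 22; 3;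
  13; 6]; [:: 3; 13; 11; 16; 3]; [:: 17; 19; 11; 4; 18]; [:: 12; 0; 0; 0; 0]].
Qed.

Lemma no_wieferich_5_29 : no_wieferich 5 29.
Proof.
by_certificate (isT : prime 29) 29 1 5 tables29 tables29_ok [:: 1; 6; 0; 0; 0]
  [:: 28; 28; 28; 28; 28] [:: 0; 0; 0; 0; 23] [:: [:: 1; 1; 1; 1; 1]; [:: 16;
  21; 21; 10; 19]; [:: 17; 6; 23; 1; 11]; [:: 27; 22; 1; 3; 5]; [:: 24; 0; 0;
  0; 0]].
Qed.

Lemma no_wieferich_5_31 : no_wieferich 5 31.
Proof.
by_certificate (isT : prime 31) 31 1 5 tables31 tables31_ok [:: 1; 7; 0; 0; 0]
  [:: 7; 10; 6; 16; 22] [:: 0; 0; 0; 0; 10] [:: [:: 1; 1; 1; 1; 1]; [:: 0; 19;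
  23; 24; 27]; [:: 24; 17; 17; 4; 0]; [:: 29; 21; 16; 21; 6]; [:: 28; 0; 0; 0;
  0]].
Qed.

Lemma no_wieferich_5_37 : no_wieferich 5 37.
Proof.
by_certificate (isT : prime 37) 37 1 5 tables37 tables37_ok [:: 1; 10; 0; 0;
  0] [:: 25; 28; 35; 16; 20] [:: 0; 0; 0; 0; 25] [:: [:: 1; 1; 1; 1; 1]; [::
  24; 35; 35; 23; 31]; [:: 15; 13; 4; 11; 31]; [:: 34; 20; 18; 16; 23]; [:: 3;
  0; 0; 0; 0]].
Qed.

Lemma no_wieferich_6_5 : no_wieferich 6 5.
Proof.
by_certificate (isT : prime 5) 5 3 6 tables5 tables5_ok [:: 2; 2; 0; 0; 0; 0]
  [:: 10; 0] [:: 6; 0] [:: [:: 1; 1; 1; 1; 1; 1]; [:: 0; 4; 4; 4; 4; 4]; [::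
  0; 0; 1; 4; 2; 3]; [:: 0; 0; 4; 4; 1; 1]; [:: 0; 0; 1; 4; 3; 2]; [:: 4; 0;
  4; 4; 4; 4]].
Qed.

Lemma no_wieferich_6_7 : no_wieferich 6 7.
Proof.
by_certificate (isT : prime 7) 7 2 6 tables7 tables7_ok [:: 5; 0; 1; 0; 0; 0]
  [:: 42; 28; 42] [:: 7; 0; 2] [:: [:: 1; 1; 1; 1; 1; 1]; [:: 4; 0; 0; 3; 0;
  0]; [:: 2; 5; 0; 2; 5; 0]; [:: 1; 4; 0; 6; 3; 0]; [:: 2; 0; 0; 2; 0; 0]; [::
  4; 5; 3; 3; 2; 4]].
Qed.

Lemma no_wieferich_6_11 : no_wieferich 6 11.
Proof.
by_certificate (isT : prime 11) 11 1 6 tables11 tables11_ok [:: 1; 1; 0; 0; 0;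
  0] [:: 2; 2; 2; 2; 2; 2] [:: 0; 0; 0; 0; 0; 9] [:: [:: 1; 1; 1; 1; 1; 1];
  [:: 8; 7; 6; 5; 4; 3]; [:: 9; 10; 8; 5; 7; 5]; [:: 9; 8; 9; 8; 6; 4]; [:: 1;
  1; 8; 2; 1; 9]; [:: 5; 0; 0; 0; 0; 0]].
Qed.

Lemma no_wieferich_6_13 : no_wieferich 6 13.
Proof.
by_certificate (isT : prime 13) 13 1 6 tables13 tables13_ok [:: 1; 2; 0; 0; 0;
  0] [:: 8; 9; 11; 12; 6; 3] [:: 11; 1; 0; 0; 0; 0] [:: [:: 1; 1; 1; 1; 1; 1];
  [:: 3; 2; 2; 2; 2; 2]; [:: 10; 10; 0; 10; 7; 2]; [:: 6; 0; 0; 3; 6; 11]; [::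
  11; 2; 11; 12; 6; 10]; [:: 6; 9; 5; 11; 5; 0]].
Qed.

Lemma no_wieferich_6_17 : no_wieferich 6 17.
Proof.
by_certificate (isT : prime 17) 17 1 6 tables17 tables17_ok [:: 1; 2; 0; 0; 0;
  0] [:: 2; 9; 2; 8; 15; 9] [:: 0; 0; 0; 0; 0; 12] [:: [:: 1; 1; 1; 1; 1; 1];
  [:: 7; 6; 15; 11; 10; 2]; [:: 5; 2; 16; 4; 5; 2]; [:: 6; 2; 5; 7; 13; 1];
  [:: 2; 2; 10; 14; 15; 8]; [:: 10; 0; 0; 0; 0; 0]].
Qed.

Lemma no_wieferich_6_19 : no_wieferich 6 19.
Proof.
by_certificate (isT : prime 19) 19 1 6 tables19 tables19_ok [:: 1; 4; 0; 0; 0;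
  0] [:: 14; 6; 18; 16; 10; 11] [:: 0; 0; 0; 0; 0; 1] [:: [:: 1; 1; 1; 1; 1;
  1]; [:: 15; 7; 11; 16; 13; 14]; [:: 5; 8; 0; 13; 11; 1]; [:: 0; 11; 4; 4;
  13; 6]; [:: 13; 7; 10; 12; 1; 14]; [:: 1; 0; 0; 0; 0; 0]].
Qed.

Lemma no_wieferich_6_23 : no_wieferich 6 23.
Proof.
by_certificate (isT : prime 23) 23 1 6 tables23 tables23_ok [:: 1; 8; 0; 0; 0;
  0] [:: 12; 12; 12; 12; 12; 12] [:: 0; 0; 0; 0; 0; 19] [:: [:: 1; 1; 1; 1; 1;
  1]; [:: 2; 15; 16; 15; 7; 14]; [:: 17; 16; 5; 17; 8; 6]; [:: 8; 22; 3; 17;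
  16; 3]; [:: 14; 10; 17; 1; 22; 5]; [:: 17; 0; 0; 0; 0; 0]].
Qed.

Lemma no_wieferich_7_3 : no_wieferich 7 3.
Proof.
by_certificate (isT : prime 3) 3 4 7 tables3 tables3_ok [:: 1; 0; 2; 0; 0; 0;
  0] [:: 37; 17] [:: 0; 3] [:: [:: 1; 1; 1; 1; 1; 1; 1]; [:: 0; 1; 2; 1; 2; 1;
  2]; [:: 0; 0; 2; 0; 0; 2; 2]; [:: 2; 0; 1; 2; 1; 2; 1]; [:: 2; 1; 2; 2; 1;
  1; 0]; [:: 1; 0; 0; 0; 0; 0; 0]; [:: 2; 0; 0; 2; 0; 0; 2]].
Qed.

Lemma no_wieferich_7_5 : no_wieferich 7 5.
Proof.
by_certificate (isT : prime 5) 5 3 7 tables5 tables5_ok [:: 1; 3; 0; 0; 0; 0;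
  0] [:: 124; 124; 4] [:: 0; 0; 2] [:: [:: 1; 1; 1; 1; 1; 1; 1]; [:: 3; 1; 3;
  2; 4; 1; 1]; [:: 1; 4; 2; 2; 3; 3; 0]; [:: 2; 3; 2; 2; 0; 4; 2]; [:: 1; 1;
  4; 0; 4; 3; 2]; [:: 1; 3; 1; 3; 2; 4; 1]; [:: 3; 0; 0; 0; 0; 0; 0]].
Qed.

Lemma no_wieferich_7_11 : no_wieferich 7 11.
Proof.
by_certificate (isT : prime 11) 11 1 7 tables11 tables11_ok [:: 1; 5; 0; 0; 0;
  0; 0] [:: 7; 2; 4; 8; 5; 10; 9] [:: 0; 0; 0; 0; 0; 0; 7] [:: [:: 1; 1; 1; 1;
  1; 1; 1]; [:: 0; 6; 5; 8; 0; 7; 7]; [:: 4; 9; 8; 6; 1; 3; 2]; [:: 2; 9; 9;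
  3; 5; 5; 0]; [:: 3; 6; 3; 1; 3; 9; 8]; [:: 3; 1; 5; 3; 1; 7; 2]; [:: 8; 0;
  0; 0; 0; 0; 0]].
Qed.

Lemma no_wieferich_7_13 : no_wieferich 7 13.
Proof.
by_certificate (isT : prime 13) 13 1 7 tables13 tables13_ok [:: 1; 3; 0; 0; 0;
  0; 0] [:: 10; 10; 4; 12; 10; 4; 12] [:: 0; 0; 0; 0; 0; 0; 8] [:: [:: 1; 1;
  1; 1; 1; 1; 1]; [:: 12; 1; 7; 12; 1; 7; 12]; [:: 8; 0; 0; 6; 4; 6; 2]; [::
  6; 5; 10; 9; 4; 0; 5]; [:: 8; 5; 1; 2; 3; 0; 7]; [:: 1; 3; 10; 11; 2; 9; 3];
  [:: 5; 0; 0; 0; 0; 0; 0]].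
Qed.

Lemma no_wieferich_8_3 : no_wieferich 8 3.
Proof.
by_certificate (isT : prime 3) 3 4 8 tables3 tables3_ok [:: 1; 0; 1; 0; 0; 0;
  0; 0] [:: 3; 0] [:: 11; 3] [:: [:: 1; 1; 1; 1; 1; 1; 1; 1]; [:: 2; 2; 0; 2;
  1; 1; 0; 1]; [:: 0; 1; 1; 1; 0; 1; 1; 1]; [:: 1; 2; 2; 0; 2; 1; 1; 0]; [::
  0; 0; 2; 1; 0; 0; 2; 1]; [:: 2; 0; 0; 0; 1; 0; 0; 0]; [:: 1; 0; 1; 1; 1; 0;
  1; 1]; [:: 0; 1; 1; 1; 0; 2; 2; 2]].
Qed.

Lemma no_wieferich_8_5 : no_wieferich 8 5.
Proof.
by_certificate (isT : prime 5) 5 3 8 tables5 tables5_ok [:: 2; 0; 0; 0; 2; 0;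
  0; 0] [:: 10; 50; 0] [:: 30; 11; 0] [:: [:: 1; 1; 1; 1; 1; 1; 1; 1]; [:: 4;
  0; 3; 0; 1; 0; 2; 0]; [:: 4; 0; 1; 0; 4; 0; 1; 0]; [:: 4; 0; 2; 0; 1; 0; 3;
  0]; [:: 2; 0; 2; 0; 2; 0; 2; 0]; [:: 0; 4; 0; 3; 0; 1; 0; 2]; [:: 1; 2; 4;
  3; 1; 2; 4; 3]; [:: 4; 4; 2; 2; 1; 1; 3; 3]].
Qed.

Lemma no_wieferich_8_7 : no_wieferich 8 7.
Proof.
by_certificate (isT : prime 7) 7 2 8 tables7 tables7_ok [:: 1; 1; 0; 0; 0; 0;
  0; 0] [:: 42; 0; 0; 0] [:: 8; 0; 0; 0] [:: [:: 1; 1; 1; 1; 1; 1; 1; 1]; [::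
  0; 6; 6; 6; 6; 6; 6; 6]; [:: 0; 0; 1; 4; 3; 2; 5; 6]; [:: 0; 0; 6; 5; 5; 3;
  3; 6]; [:: 0; 0; 1; 1; 6; 1; 6; 6]; [:: 0; 0; 6; 3; 3; 5; 5; 6]; [:: 0; 0;
  1; 2; 5; 4; 3; 6]; [:: 6; 0; 6; 6; 6; 6; 6; 6]].
Qed.

Lemma no_wieferich_9_5 : no_wieferich 9 5.
Proof.
by_certificate (isT : prime 5) 5 3 9 tables5 tables5_ok [:: 1; 0; 0; 0; 4; 0;
  0; 0; 0] [:: 20; 0; 0] [:: 9; 0; 0] [:: [:: 1; 1; 1; 1; 1; 1; 1; 1; 1]; [::
  2; 1; 1; 1; 1; 1; 1; 1; 1]; [:: 4; 0; 0; 0; 0; 0; 0; 0; 1]; [:: 0; 4; 0; 2;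
  3; 0; 1; 3; 2]; [:: 1; 2; 0; 1; 4; 0; 3; 0; 4]; [:: 1; 2; 1; 1; 1; 1; 1; 1;
  1]; [:: 3; 4; 4; 0; 2; 3; 0; 1; 3]; [:: 1; 3; 0; 1; 0; 2; 1; 3; 4]; [:: 0;
  4; 3; 0; 0; 3; 4; 2; 4]].
Qed.

Lemma no_wieferich_10_3 : no_wieferich 10 3.
Proof.
by_certificate (isT : prime 3) 3 4 10 tables3 tables3_ok [:: 2; 0; 1; 0; 0; 0;
  0; 0; 0; 0] [:: 27; 33; 6] [:: 3; 0; 2] [:: [:: 1; 1; 1; 1; 1; 1; 1; 1; 1;
  1]; [:: 2; 0; 0; 0; 0; 1; 0; 0; 0; 0]; [:: 1; 1; 2; 2; 0; 1; 1; 2; 2; 0];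
  [:: 0; 2; 0; 0; 0; 0; 1; 0; 0; 0]; [:: 2; 0; 2; 1; 1; 2; 0; 2; 1; 1]; [:: 1;
  0; 1; 1; 2; 2; 0; 2; 2; 1]; [:: 0; 1; 1; 2; 2; 0; 1; 1; 2; 2]; [:: 2; 1; 1;
  2; 0; 1; 2; 2; 1; 0]; [:: 1; 0; 0; 0; 0; 1; 0; 0; 0; 0]; [:: 0; 0; 2; 0; 0;
  0; 0; 1; 0; 0]].
Qed.

Lemma no_wieferich_11_3 : no_wieferich 11 3.
Proof.
by_certificate (isT : prime 3) 3 4 11 tables3 tables3_ok [:: 1; 0; 2; 0; 0; 0;
  0; 0; 0; 0; 0] [:: 6; 0; 0] [:: 5; 0; 0] [:: [:: 1; 1; 1; 1; 1; 1; 1; 1; 1;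
  1; 1]; [:: 2; 1; 1; 1; 1; 1; 1; 1; 1; 1; 1]; [:: 0; 1; 0; 1; 1; 2; 2; 0; 0;
  2; 0]; [:: 1; 2; 1; 1; 1; 1; 1; 1; 1; 1; 1]; [:: 2; 0; 0; 0; 0; 0; 0; 0; 0;
  0; 1]; [:: 0; 2; 0; 2; 2; 1; 1; 0; 0; 2; 2]; [:: 0; 0; 1; 0; 1; 1; 2; 2; 0;
  0; 2]; [:: 0; 1; 2; 2; 1; 2; 2; 0; 0; 1; 1]; [:: 1; 1; 1; 2; 0; 1; 2; 0; 2;
  0; 2]; [:: 1; 1; 2; 1; 1; 1; 1; 1; 1; 1; 1]; [:: 2; 2; 1; 2; 2; 1; 2; 2; 0;
  0; 1]].
Qed.

Lemma no_wieferich_11_5 : no_wieferich 11 5.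
Proof.
by_certificate (isT : prime 5) 5 3 11 tables5 tables5_ok [:: 1; 3; 0; 0; 0; 0;
  0; 0; 0; 0; 0] [:: 5; 0; 0; 0] [:: 6; 0; 0; 0] [:: [:: 1; 1; 1; 1; 1; 1; 1;
  1; 1; 1; 1]; [:: 0; 4; 4; 4; 4; 4; 4; 4; 4; 4; 4]; [:: 3; 1; 2; 0; 2; 4; 4;
  3; 1; 2; 3]; [:: 4; 0; 1; 4; 1; 4; 1; 4; 1; 4; 1]; [:: 4; 4; 3; 4; 2; 4; 2;
  4; 2; 4; 2]; [:: 4; 0; 4; 4; 4; 4; 4; 4; 4; 4; 4]; [:: 0; 3; 3; 0; 4; 0; 4;
  4; 0; 4; 3]; [:: 4; 0; 2; 3; 1; 0; 0; 2; 4; 4; 0]; [:: 3; 3; 3; 3; 1; 0; 2;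
  3; 2; 2; 3]; [:: 3; 0; 1; 2; 4; 1; 2; 0; 0; 4; 3]; [:: 3; 3; 1; 2; 0; 2; 4;
  4; 3; 1; 2]].
Qed.

Lemma no_wieferich_13_3 : no_wieferich 13 3.
Proof.
by_certificate (isT : prime 3) 3 4 13 tables3 tables3_ok [:: 1; 1; 0; 0; 0; 0;
  0; 0; 0; 0; 0; 0; 0] [:: 3; 0; 0; 0] [:: 1; 1; 0; 0] [:: [:: 1; 1; 1; 1; 1;
  1; 1; 1; 1; 1; 1; 1; 1]; [:: 2; 0; 2; 2; 0; 0; 2; 0; 1; 1; 2; 1; 2]; [:: 2;
  1; 0; 2; 2; 1; 0; 2; 1; 0; 0; 2; 2]; [:: 2; 2; 0; 2; 2; 0; 0; 2; 0; 1; 1; 2;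
  1]; [:: 0; 2; 2; 2; 2; 2; 2; 2; 2; 2; 2; 2; 2]; [:: 0; 0; 1; 1; 1; 0; 1; 1;
  1; 1; 1; 0; 1]; [:: 2; 2; 1; 0; 2; 2; 1; 0; 2; 1; 0; 0; 2]; [:: 1; 1; 0; 0;
  2; 2; 1; 2; 1; 0; 2; 2; 1]; [:: 0; 2; 2; 0; 1; 0; 2; 1; 0; 1; 2; 1; 0]; [::
  1; 2; 2; 0; 2; 2; 0; 0; 2; 0; 1; 1; 2]; [:: 1; 2; 1; 0; 1; 2; 1; 0; 2; 1; 2;
  0; 2]; [:: 1; 0; 0; 0; 1; 2; 1; 0; 2; 1; 2; 0; 2]; [:: 2; 0; 2; 2; 2; 2; 2;
  2; 2; 2; 2; 2; 2]].
Qed.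

Lemma no_wieferich_14_3 : no_wieferich 14 3.
Proof.
by_certificate (isT : prime 3) 3 4 14 tables3 tables3_ok [:: 1; 1; 0; 0; 0; 0;
  0; 0; 0; 0; 0; 0; 0; 0] [:: 80; 80; 80; 8] [:: 11; 0; 0; 0] [:: [:: 1; 1; 1;
  1; 1; 1; 1; 1; 1; 1; 1; 1; 1; 1]; [:: 2; 0; 1; 2; 2; 2; 0; 1; 2; 2; 0; 2; 2;
  0]; [:: 2; 1; 1; 1; 1; 1; 1; 1; 1; 1; 1; 1; 1; 1]; [:: 0; 2; 0; 1; 2; 2; 2;
  0; 1; 2; 2; 0; 2; 2]; [:: 0; 2; 2; 1; 1; 0; 2; 1; 1; 0; 1; 1; 0; 0]; [:: 1;
  2; 0; 0; 0; 1; 2; 0; 0; 1; 0; 0; 1; 1]; [:: 1; 2; 1; 1; 1; 1; 1; 1; 1; 1; 1;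
  1; 1; 1]; [:: 0; 0; 2; 0; 2; 0; 2; 1; 1; 2; 1; 1; 2; 1]; [:: 1; 0; 1; 2; 1;
  2; 1; 1; 0; 2; 1; 0; 2; 1]; [:: 2; 0; 2; 0; 1; 2; 2; 2; 0; 1; 2; 2; 0; 2];
  [:: 1; 0; 1; 0; 2; 1; 2; 1; 2; 0; 2; 2; 2; 2]; [:: 0; 1; 2; 1; 0; 0; 0; 0;
  2; 0; 0; 2; 1; 0]; [:: 0; 0; 2; 2; 1; 1; 0; 2; 1; 1; 0; 1; 1; 0]; [:: 2; 1;
  1; 2; 0; 1; 1; 0; 2; 0; 0; 2; 2; 2]].
Qed.

Local Open Scope ring_scope.

Theorem proposition5p2 (d p : nat)
  (hdp : [|| (d == 5)%N && (p \in [:: 3; 7; 11; 13; 17; 19; 23; 29; 31; 37]%N),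
             (d == 6)%N && (p \in [:: 5; 7; 11; 13; 17; 19; 23]%N),
             (d == 7)%N && (p \in [:: 3; 5; 11; 13]%N),
             (d == 8)%N && (p \in [:: 3; 5; 7]%N),
             (d == 9)%N && (p == 5)%N,
             (d == 10)%N && (p == 3)%N,
             (d == 11)%N && (p \in [:: 3; 5]%N),
             (d == 13)%N && (p == 3)%N
           | (d == 14)%N && (p == 3)%N]) :
  ~~ (p %| d)%N /\
  ~ (exists P : {poly 'F_p}, size P = d.+1 /\ c_wieferich P).
Proof.
move: hdp; rewrite !inE.
by do ![case/orP]; case/andP=> /eqP->; do ?[case/orP]; move/eqP->; split=> //;
  first [ exact: no_wieferich_5_3 | exact: no_wieferich_5_7 |
    exact: no_wieferich_5_11 | exact: no_wieferich_5_13 |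
    exact: no_wieferich_5_17 | exact: no_wieferich_5_19 |
    exact: no_wieferich_5_23 | exact: no_wieferich_5_29 |
    exact: no_wieferich_5_31 | exact: no_wieferich_5_37 |
    exact: no_wieferich_6_5 | exact: no_wieferich_6_7 |
    exact: no_wieferich_6_11 | exact: no_wieferich_6_13 |
    exact: no_wieferich_6_17 | exact: no_wieferich_6_19 |
    exact: no_wieferich_6_23 | exact: no_wieferich_7_3 |
    exact: no_wieferich_7_5 | exact: no_wieferich_7_11 |
    exact: no_wieferich_7_13 | exact: no_wieferich_8_3 |
    exact: no_wieferich_8_5 | exact: no_wieferich_8_7 |
    exact: no_wieferich_9_5 | exact: no_wieferich_10_3 |
    exact: no_wieferich_11_3 | exact: no_wieferich_11_5 |
    exact: no_wieferich_13_3 | exact: no_wieferich_14_3 ].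
Qed.
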